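(* Let $c_0\in\mathbb{R}$ and suppose $(V,H,E,\Theta)$ is a varifold with enclosed volume such that $\operatorname{spt}\mu_V$ is compact. Then $$\theta^2(\mu_V,x_0)\le\frac1{4\pi}\mathcal{H}_{c_0}(V)+\frac{c_0}{2\pi}\int_E\frac{\Theta(x)}{|x-x_0|^2}\,d\mathcal{L}^3(x)$$ for all $x_0\in\mathbb{R}^3$, provided the second term on the right hand side exists.
   Context: $\mathbb{G}^{\mathrm o}(3,2)=\{\xi\in\bigwedge_2\mathbb{R}^3:\ \xi\text{ simple},\ |\xi|=1\}$; $T(\xi)=\{v\in\mathbb{R}^3:v\wedge\xi=0\}$; $\star\xi\in\mathbb{S}^2$ is the Hodge dual ($\star(v_1\wedge v_2)=v_1\times v_2$). An oriented $2$-varifold on $\mathbb{R}^3$ is a Radon measure $V$ on $\mathbb{G}_2^{\mathrm o}(\mathbb{R}^3)=\mathbb{R}^3\times\mathbb{G}^{\mathrm o}(3,2)$ (set of these: $\mathbb{V}_2^{\mathrm o}(\mathbb{R}^3)$), with weight measure $\mu_V$ the push forward of $V$ to $\mathbb{R}^3$, and first variation $\delta V(X)=\int\operatorname{div}_{T(\xi)}X(x)\,dV(x,\xi)$, where $\operatorname{div}_TX=\sum_{j=1}^2\langle e_j,DX\,e_j\rangle$ for an orthonormal basis $e_1,e_2$ of $T$. $(V,H,E,\Theta)$ is a varifold with enclosed volume if: $V\in\mathbb{V}_2^{\mathrm o}(\mathbb{R}^3)$ and $H\in L^1_{\mathrm{loc}}(\mu_V;\mathbb{R}^3)$ satisfy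 $\delta V(X)=-\int\langle X,H\rangle\,d\mu_V$ for all $X\in C_c^1(\mathbb{R}^3;\mathbb{R}^3)$ and $H(x)\wedge\star\xi=0$ for $V$-almost all $(x,\xi)$; $E\subset\mathbb{R}^3$ is $\mathcal{L}^3$-measurable; $\Theta\in L^1_{\mathrm{loc}}(\mathcal{L}^3\llcorner E;\mathbb{N})$ with $\mathbb{N}=\{1,2,\dots\}$; $\operatorname{diam}\operatorname{spt}(\mathcal{L}^3\llcorner E)\le\operatorname{diam}\operatorname{spt}\mu_V$; and $-\int_{\mathbb{G}_2^{\mathrm o}(\mathbb{R}^3)}\langle X(x),\star\xi\rangle\,dV(x,\xi)=\int_E(\operatorname{div}X)\,\Theta\,d\mathcal{L}^3$ for all Lipschitz $X\colon\mathbb{R}^3\to\mathbb{R}^3$ with compact support. The Helfrich energy is $\mathcal{H}_{c_0}(V)=\frac14\int|H(x)-c_0(\star\xi)|^2\,dV(x,\xi)\in[0,\infty]$; the density is $\theta^2(\mu_V,x)=\lim_{\rho\to0+}\mu_V(B_\rho(x))/(\pi\rho^2)$ (closed balls). An integral exists if and only if its integrand is Lebesgue integrable. *)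

(* Defs.v *)
From HB Require Import structures.
From mathcomp Require Import all_boot all_order all_algebra.
From mathcomp Require Import all_classical all_reals all_analysis.
From mathcomp Require Import ring.

Set Implicit Arguments.
Unset Strict Implicit.
Unset Printing Implicit Defensive.

Import Order.TTheory GRing.Theory Num.Theory.
Import numFieldNormedType.Exports.

Local Open Scope classical_set_scope.
Local Open Scope ring_scope.

(* With triples, the topology, the vector space structure and the product
   (= Borel) sigma-algebra of R^3 are those of the library. The norm of the
   library on R * R * R is the sup norm; it is only used in the Lipschitz
   condition, where it may be exchanged for the Euclidean norm vnorm. *)
Notation R3 R := (R * R * R)%type (only parsing).

(* The 2-vectors of R^3: (a, b, c) stands for
   a (e1 /\ e2) + b (e1 /\ e3) + c (e2 /\ e3). These three basis elements are
   orthonormal, so that the norm of a 2-vector is again vnorm. *)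
Notation bivector R := (R * R * R)%type (only parsing).

Section exterior_algebra.
Context {R : realType}.
Implicit Types (u v w : R3 R) (xi : bivector R).

Definition vdot (v w : R * R * R) : R :=
  v.1.1 * w.1.1 + v.1.2 * w.1.2 + v.2 * w.2.

Definition vnorm (v : R * R * R) : R := Num.sqrt (vdot v v).

Definition vwedge v w : bivector R :=
  (v.1.1 * w.1.2 - v.1.2 * w.1.1,
   v.1.1 * w.2 - v.2 * w.1.1,
   v.1.2 * w.2 - v.2 * w.1.2).

(* The 3-vector v /\ xi, as a multiple of e1 /\ e2 /\ e3. *)
Definition wedge3 v xi : R := v.1.1 * xi.2 - v.1.2 * xi.1.2 + v.2 * xi.1.1.

Definition vcross v w : R3 R :=
  (v.1.2 * w.2 - v.2 * w.1.2,
   v.2 * w.1.1 - v.1.1 * w.2,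
   v.1.1 * w.1.2 - v.1.2 * w.1.1).

Definition star xi : R3 R := (xi.2, - xi.1.2, xi.1.1).

Lemma star_vwedge v w : star (vwedge v w) = vcross v w.
Proof. by rewrite /star /vcross /= opprB. Qed.

Lemma wedge3_vwedge u v w : wedge3 u (vwedge v w) = vdot u (vcross v w).
Proof. by rewrite /wedge3 /vdot /=; ring. Qed.

Lemma vdot_vwedge v1 v2 w1 w2 : vdot (vwedge v1 v2) (vwedge w1 w2) =
  vdot v1 w1 * vdot v2 w2 - vdot v1 w2 * vdot v2 w1.
Proof. by rewrite /vdot /=; ring. Qed.

Definition simple_bivector xi := exists v w, xi = vwedge v w.

Definition tangent xi : set (R3 R) := [set v | wedge3 v xi = 0].

Definition orthonormal_basis (T : set (R3 R)) (e : R3 R * R3 R) :=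
  [/\ vdot e.1 e.1 = 1, vdot e.2 e.2 = 1, vdot e.1 e.2 = 0 &
      T = [set a *: e.1 + b *: e.2 | a in [set: R] & b in [set: R]]].

End exterior_algebra.

(* The oriented Grassmannian, with the subspace topology and its Borel
   sigma-algebra. *)
Definition oriented_planes (R : realType) : set (bivector R) :=
  [set xi | simple_bivector xi /\ vnorm xi = 1].

Definition G32 (R : realType) : Type := set_type (@oriented_planes R).

Lemma oriented_planes_e12 (R : realType) : (1, 0, 0) \in @oriented_planes R.
Proof.
rewrite inE; split; last by rewrite /vnorm /vdot /= !mulr1 !mulr0 !addr0 sqrtr1.
by exists (1, 0, 0), (0, 1, 0); rewrite /vwedge /= !(mulr0, mulr1, mul0r, subr0).
Qed.

HB.instance Definition _ (R : realType) := Topological.on (G32 R).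
HB.instance Definition _ (R : realType) :=
  isPointed.Build (G32 R) (SigSub (@oriented_planes_e12 R)).
HB.instance Definition _ (R : realType) :=
  Measurable.copy (G32 R) (g_sigma_algebraType (@open (G32 R))).

Definition biv (R : realType) (xi : G32 R) : bivector R := \val xi.

Section measures.
Context {R : realType}.
Local Open Scope ereal_scope.

Local Notation borel_lebesgue3 :=
  ((@lebesgue_measure R \x @lebesgue_measure R) \x @lebesgue_measure R).

(* R^3 with the sigma-algebra of Lebesgue measurable (not only Borel) sets. *)
Definition lebesgue_R3 : measurableType _ :=
  caratheodory_type (borel_lebesgue3^*)%mu.

Definition lebesgue3 :=
  @completed_measure_extension _ _ _ borel_lebesgue3.

HB.instance Definition _ := Measure.on lebesgue3.

Definition spt (mu : set (R3 R) -> \bar R) : set (R3 R) :=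
  [set x | forall U, open_nbhs x U -> 0 < mu U].

(* The maximum with 0 gives the empty set diameter 0; it changes nothing else. *)
Definition diam (A : set (R3 R)) : \bar R :=
  maxe 0 (ereal_sup [set (vnorm (x - y)%R)%:E | x in A & y in A]).

Definition cball (x : R3 R) (r : R) : set (R3 R) :=
  [set y | (vnorm (y - x) <= r)%R].

Definition density_ratio (mu : set (R3 R) -> \bar R) (x : R3 R) (r : R) :=
  mu (cball x r) * ((pi * r ^+ 2)^-1)%:E.

(* The limit is meaningful only if it exists; lim is a total operator. *)
Definition density2 (mu : set (R3 R) -> \bar R) (x : R3 R) : \bar R :=
  lim (density_ratio mu x r @[r --> 0^'+]).

End measures.

Section vector_fields.
Context {R : realType}.
Implicit Types (X : R3 R -> R3 R) (x : R3 R) (T : set (R3 R)).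

Definition divergence X x : R :=
  ('D_(1, 0, 0) X x).1.1 + ('D_(0, 1, 0) X x).1.2 + ('D_(0, 0, 1) X x).2.

(* The orthonormal basis of T is an arbitrarily chosen one. *)
Definition divergence_along T X x : R :=
  let e := xget (0, 0) (orthonormal_basis T) in
  vdot e.1 ('D_e.1 X x) + vdot e.2 ('D_e.2 X x).

Definition compactly_supported X := compact (closure [set x | X x != 0]).

Definition C1 X := (forall x, differentiable X x) /\
  (forall v, continuous (fun x => 'D_v X x)).

End vector_fields.

Section varifolds.
Context {R : realType}.
Local Open Scope ereal_scope.

Local Notation oriented_varifold_space := (R3 R * G32 R)%type.
Implicit Types (V : {measure set oriented_varifold_space -> \bar R}).

(* R^3 x G^o(3,2) carries its Borel sigma-algebra. On this space, which
   is locally compact and second countable, a Borel measure is Radon as soon as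
   it is finite on compact sets. *)
Definition oriented_varifold V :=
  forall K : set oriented_varifold_space, compact K -> V K < +oo.

Definition weight V : set (R3 R) -> \bar R := pushforward V fst.

Definition first_variation V (X : R3 R -> R3 R) : \bar R :=
  \int[V]_p (divergence_along (tangent (biv p.2)) X p.1)%:E.

Definition helfrich (c0 : R) V (H : R3 R -> R3 R) : \bar R :=
  (4^-1)%:E * \int[V]_p (vnorm (H p.1 - c0 *: star (biv p.2))%R ^+ 2)%:E.

(* H is a Borel representative of its class in L^1_loc(weight V; R^3). *)
Record enclosed_volume V (H : R3 R -> R3 R) (E : set (R3 R))
    (Theta : R3 R -> nat) : Prop := {
  ev_varifold : oriented_varifold V;
  ev_H_measurable : measurable_fun [set: R3 R] H;
  ev_H_locint : forall K : set (R3 R), compact K ->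
    \int[weight V]_(x in K) (vnorm (H x))%:E < +oo;
  ev_first_variation : forall X, C1 X -> compactly_supported X ->
    first_variation V X = - \int[weight V]_x (vdot (X x) (H x))%:E;
  ev_H_normal : {ae V, forall p, vwedge (H p.1) (star (biv p.2)) = 0%R};
  ev_E_measurable : measurable (E : set lebesgue_R3);
  ev_Theta_pos : forall x, E x -> (0 < Theta x)%N;
  ev_Theta_measurable :
    measurable_fun (E : set lebesgue_R3) (Theta : lebesgue_R3 -> nat);
  ev_Theta_locint : forall K : set (R3 R), compact K ->
    \int[lebesgue3]_(x in E `&` K) ((Theta x)%:R)%:E < +oo;
  ev_diam : diam (spt (fun A => lebesgue3 (A `&` E))) <= diam (spt (weight V));
  ev_volume : forall X : R3 R -> R3 R,
    lipschitz X -> compactly_supported X ->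
    (- \int[V]_p (vdot (X p.1) (star (biv p.2)))%:E) =
    \int[lebesgue3]_(x in E) (divergence X x * (Theta x)%:R)%:E
}.

End varifolds.

(* Main.v *)
(* Write y = x - x0, t = |y|^2, nu = star xi, s = <y, nu>; since H is normal,
   H = h nu, and with k = h - c0 the Helfrich energy is 1/4 \int k^2 dV. Testing
   the first variation and the volume identity with the same radial field
   y / max(t, tau), cut off far away, and adding c0 times the latter to the former
   cancels the terms linear in c0. Since 2 s^2/t^2 + s k/t = 2 (s/t + k/4)^2 - k^2/8,
   this reads
     2 mu(t <= tau) / tau + \int_{t > tau} 2 (s/t + k/4)^2 dV
       = 1/8 \int_{t > tau} k^2 dV + c0 G(tau) - 1/tau \int_{t <= tau} s k dV
   where G(tau) tends to \int_E Theta/t as tau -> 0+. By Young's inequality the last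
   term is small relative to mu(t <= tau) / tau, so this ratio is first bounded and
   then, the integral on the left being monotone in tau, convergent.
   As the test field has to be C^1, max(t, tau) is first replaced by softmax below
   and recovered by dominated convergence. *)

(* For finite energy the existence of the density is part of the claim, and it is obtained by
   solving the balance for the area ratio and showing that every other term converges. The obstacle
   is the term with s k. To make it vanish, the integral of k^2 over t <= tau must tend to 0, so x0
   must carry no mass; this needs a bound on the area ratio, which is itself the quantity under
   study. The circle is broken by using Young's inequality twice. With weight 1 it absorbs the term
   into twice the area ratio and gives the bound; the bound gives mass O(tau) for t <= tau, hence no
   mass at x0; then a small weight gives convergence to 0. The existence of the second term supplies
   the dominating function for the integrals over E. The diameter condition confines E, up to a null
   set, to a ball, so that one cutoff is invisible in both identities. *)
Require Import Defs.
From mathcomp Require Import all_boot all_order all_algebra.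
From mathcomp Require Import all_classical all_reals all_analysis.
From mathcomp Require Import measurable_realfun ring lra.

Set Implicit Arguments.
Unset Strict Implicit.
Unset Printing Implicit Defensive.

Import Order.TTheory GRing.Theory Num.Theory.
Import numFieldNormedType.Exports.

Local Open Scope classical_set_scope.
Local Open Scope ring_scope.

(** * A continuously differentiable substitute for the maximum *)

Section softmax.
Context {R : realType}.
Implicit Types (tau delta t : R).

Definition pospart t : R := Num.max t 0.

(** The primitive of a ramp that climbs from 0 to 1 on [tau, tau + delta]. The ramp starts at tau
    instead of being centred there, so its value is 0 on all of t <= tau and it tends everywhere to
    the indicator of tau < t. The sphere t = tau, which V may charge, is thus counted with the
    closed ball. *)
Definition softmax tau delta t : R :=
  tau + (pospart (t - tau) ^+ 2 - pospart (t - tau - delta) ^+ 2) / (2 * delta).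

Definition softmax' tau delta t : R :=
  (pospart (t - tau) - pospart (t - tau - delta)) / delta.

Lemma pospart_ge0 t : 0 <= pospart t.
Proof. by rewrite /pospart le_max lexx orbT. Qed.

Lemma pospart_id t : 0 <= t -> pospart t = t.
Proof. by move=> t0; rewrite /pospart; case: ltrP => //; lra. Qed.

Lemma pospart_eq0 t : t <= 0 -> pospart t = 0.
Proof. by move=> t0; rewrite /pospart; case: ltrP => //; lra. Qed.

Lemma le_pospart : {homo pospart : x y / x <= y}.
Proof.
move=> x y xy; rewrite /pospart ge_max !le_max.
by rewrite xy lexx !orbT.
Qed.

Lemma softmax_low tau delta t : 0 < delta -> t <= tau ->
  softmax tau delta t = tau /\ softmax' tau delta t = 0.
Proof.
move=> d0 tt; rewrite /softmax /softmax' !pospart_eq0; [|lra|lra].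
by rewrite expr0n/= !subrr !mul0r addr0.
Qed.

Lemma softmax_high tau delta t : 0 < delta -> tau + delta <= t ->
  softmax tau delta t = t - delta / 2 /\ softmax' tau delta t = 1.
Proof.
move=> d0 tt; rewrite /softmax /softmax' !pospart_id; [|lra|lra].
by split; field; lra.
Qed.

Lemma softmax_ge tau delta t : 0 < delta -> tau <= softmax tau delta t.
Proof.
move=> d0; rewrite /softmax lerDl divr_ge0//; last by lra.
rewrite subr_ge0 lerXn2r ?nnegrE ?pospart_ge0//.
by apply: le_pospart; lra.
Qed.

Lemma softmax'_ge0 tau delta t : 0 < delta -> 0 <= softmax' tau delta t.
Proof.
move=> d0; rewrite /softmax' divr_ge0//; last by lra.
by rewrite subr_ge0; apply: le_pospart; lra.
Qed.

Lemma softmax'_le1 tau delta t : 0 < delta -> softmax' tau delta t <= 1.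
Proof.
move=> d0; rewrite /softmax' ler_pdivrMr// mul1r lerBlDr.
have p0 := pospart_ge0 (t - tau - delta).
have [?|?] := leP 0 (t - tau); last by rewrite (@pospart_eq0 (t - tau)); lra.
rewrite (@pospart_id (t - tau))//.
by rewrite /pospart; case: (ltrP (t - tau - delta) 0) => ?; lra.
Qed.

Lemma is_derive_pospart_sqr t :
  is_derive t 1 (fun u => pospart u ^+ 2) (2 * pospart t).
Proof.
suff h : (fun h => h^-1 *: ((pospart (h + t)) ^+ 2 - pospart t ^+ 2)) @ 0^' --> 2 * pospart t.
  apply: DeriveDef; last first.
    apply/cvg_lim => //.
    by under eq_fun do rewrite -[_%:A]/(_ * 1) mulr1; exact: h.
  apply/cvg_ex; exists (2 * pospart t).
  by under eq_fun do rewrite -[_%:A]/(_ * 1) mulr1; exact: h.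
apply/cvgrPdist_le => /= e e0.
near=> h; rewrite ler_distl.
have h0 : h != 0 by near: h; exact: nbhs_dnbhs_neq.
have he : `|h| <= e.
  by near: h; exact: dnbhs0_le.
(* Squaring removes the kink: in each of the four sign cases of t and t + h the first-order
   remainder is at most h^2, so the difference quotient errs by at most |h|. *)
have key : `|pospart (h + t) ^+ 2 - pospart t ^+ 2 - h * (2 * pospart t)| <= h ^+ 2.
  rewrite /pospart; case: (ltrP (h + t) 0) => a; case: (ltrP t 0) => b;
    by rewrite ler_norml; apply/andP; split; nra.
have hh : h^-1 *: (pospart (h + t) ^+ 2 - pospart t ^+ 2) - 2 * pospart t
  = h^-1 * (pospart (h + t) ^+ 2 - pospart t ^+ 2 - h * (2 * pospart t)).
  by rewrite -[_ *: _]/(_ * _); field.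
rewrite -ler_distl distrC hh normrM normfV ler_pdivrMl ?normr_gt0//.
rewrite (le_trans key)// -real_normK ?num_real// expr2 ler_wpM2l//.
Unshelve. all: by end_near. Qed.

Lemma is_derive_softmax tau delta t : 0 < delta ->
  is_derive t 1 (softmax tau delta) (softmax' tau delta t).
Proof.
move=> d0.
have shift (c : R) : is_derive t 1 (fun u => pospart (u - c) ^+ 2) (2 * pospart (t - c)).
  have -> : (fun u => pospart (u - c) ^+ 2) = (fun u => pospart u ^+ 2) \o (fun u => u - c) by [].
  have h1 : is_derive t 1 (fun u => u - c) (1 : R).
    by apply: is_derive_eq; rewrite subr0.
  have h2 := is_derive_pospart_sqr (t - c).
  have := @is_derive1_comp _ (fun u => pospart u ^+ 2) (fun u => u - c) t _ _ h2 h1.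
  by rewrite mulr1.
have s1 := shift tau.
have s2 : is_derive t 1 (fun u => pospart (u - tau - delta) ^+ 2) (2 * pospart (t - tau - delta)).
  have := shift (tau + delta).
  by under eq_fun do rewrite opprD addrA; rewrite opprD addrA.
have -> : softmax tau delta = (cst tau : R -> R) + (2 * delta)^-1 *:
    ((fun u => pospart (u - tau) ^+ 2) - (fun u => pospart (u - tau - delta) ^+ 2)).
  by apply/funext => u; rewrite /softmax [in LHS]mulrC.
have d12 := is_deriveZ (2 * delta)^-1 (is_deriveB s1 s2).
apply: (is_derive_eq (is_deriveD (is_derive_cst tau t 1) d12)).
rewrite add0r /softmax' -mulrBr -[_ *: _]/(_ * _).
by field; lra.
Qed.

Lemma continuous_pospart : continuous pospart.
Proof.
move=> x; rewrite /pospart; apply: (@continuous_max _ R) => //.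
exact: cst_continuous.
Qed.

Lemma continuous_softmax' tau delta : continuous (softmax' tau delta).
Proof.
have sh (c : R) : continuous (fun u : R => u - c).
  by move=> x; apply: cvgB; [exact: cvg_id|exact: cvg_cst].
move=> x; apply: cvgMl; apply: cvgB.
  apply: (@continuous_comp _ _ _ (fun u => u - tau) pospart); first exact: sh.
  exact: continuous_pospart.
apply: (@continuous_comp _ _ _ (fun u => u - tau - delta) pospart); last exact: continuous_pospart.
by move=> y; apply: cvgB; [exact: sh|exact: cvg_cst].
Qed.

Lemma continuous_softmax tau delta : 0 < delta -> continuous (softmax tau delta).
Proof.
move=> d0 x; apply: differentiable_continuous; apply/derivable1_diffP.
by have [] := is_derive_softmax tau x d0.
Qed.

Lemma cvg_softmax' tau t : softmax' tau n.+1%:R^-1 t @[n --> \oo] --> ((tau < t)%R%:R : R).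
Proof.
apply: cvg_near_cst; have [tt|tt] := leP t tau.
  by near=> n; have [|_ ->] := @softmax_low tau n.+1%:R^-1 t _ tt.
near=> n; have [||_ ->//] := @softmax_high tau n.+1%:R^-1 t => //.
rewrite -lerBrDl ltW//; near: n.
have tt' : 0 < t - tau by rewrite subr_gt0.
exact: (near_infty_natSinv_lt (PosNum tt')).
Unshelve. all: by end_near. Qed.

Lemma cvg_softmax tau t :
  softmax tau n.+1%:R^-1 t @[n --> \oo] --> Num.max t tau.
Proof.
have [tt|tt] := leP t tau.
  by apply: cvg_near_cst; near=> n; have [|->] := @softmax_low tau n.+1%:R^-1 t _ tt.
have h : t - n.+1%:R^-1 / 2 @[n --> \oo] --> t.
  rewrite -[X in _ --> X](subr0 t); apply: cvgB; first exact: cvg_cst.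
  by rewrite -(mul0r 2^-1); apply: cvgM; [exact: cvg_harmonic|exact: cvg_cst].
apply: cvg_trans h; apply: near_eq_cvg.
near=> n; have [||-> //] := @softmax_high tau n.+1%:R^-1 t => //.
rewrite -lerBrDl ltW//; near: n.
have tt' : 0 < t - tau by rewrite subr_gt0.
exact: (near_infty_natSinv_lt (PosNum tt')).
Unshelve. all: by end_near. Qed.

End softmax.

(** * Real-valued integrals *)

Section rintegral_complements.
Context d (T : measurableType d) (R : realType).
Variables (mu : {measure set T -> \bar R}) (D : set T).
Hypothesis mD : measurable D.

Lemma measurable_fun_ler_natr (f g : T -> R) :
  measurable_fun D f -> measurable_fun D g ->
  measurable_fun D (fun x => (f x <= g x)%R%:R : R).
Proof.
move=> mf mg.
have -> : (fun x => (f x <= g x)%R%:R : R) = (fun x => if f x <= g x then 1 else 0).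
  by apply/funext => x; case: ifP.
by apply: measurable_fun_if => //; exact: measurable_fun_ler.
Qed.

Lemma dominated_convergence_Rintegral (f_ : nat -> T -> R) (f g : T -> R) :
  (forall n, measurable_fun D (f_ n)) -> measurable_fun D f ->
  mu.-integrable D (EFin \o g) ->
  {ae mu, forall x, D x -> f_ n x @[n --> \oo] --> f x} ->
  {ae mu, forall x, D x -> forall n, `|f_ n x| <= g x} ->
  \int[mu]_(x in D) f_ n x @[n --> \oo] --> \int[mu]_(x in D) f x.
Proof.
move=> mf_ mf ig ff fg.
have [||||| i0 _ h] := @dominated_convergence _ T R mu D mD
    (fun n => EFin \o f_ n) (EFin \o f) (EFin \o g).
- by move=> n; apply/measurable_EFinP.
- exact/measurable_EFinP.
- apply: filterS ff => x h Dx; apply: cvg_EFin => //; first by near=> n.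
  exact: h.
- exact: ig.
- by apply: filterS fg => x h n Dx; rewrite lee_fin; exact: h.
apply: fine_cvg; rewrite fineK//; exact: integrable_fin_num.
Unshelve. all: by end_near. Qed.

(** The integrand is eventually 0 at almost every point: either t x <= 0 and f vanishes there, or r
    drops below t x. It is dominated by |f|. *)
Lemma cvg_Rintegral_sublevel0 (t f : T -> R) :
  measurable_fun D t -> mu.-integrable D (EFin \o f) ->
  {ae mu, forall x, D x -> t x <= 0 -> f x = 0} ->
  \int[mu]_(x in D) ((t x <= r)%R%:R * f x) @[r --> 0^'+] --> (0 : R).
Proof.
move=> mt intf f0; have mf : measurable_fun D f.
  exact/measurable_EFinP/(measurable_int _ intf).
apply/cvg_at_rightP => u [u0 uc].
have -> : (0 : R) = \int[mu]_(x in D) (cst 0 x).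
  by rewrite Rintegral_cst// mul0r.
apply: (@dominated_convergence_Rintegral _ _ (fun x => `|f x|)) => //.
- move=> n; apply: measurable_funM => //.
  exact: measurable_fun_ler_natr.
- exact: integrable_norm.
- apply: filterS f0 => x h Dx; apply: cvg_near_cst.
  have [tx|tx] := leP (t x) 0.
    by near=> n; rewrite h// mulr0.
  near=> n; rewrite [_ <= _](_ : _ = false) ?mul0r//; apply/negbTE.
  by rewrite -ltNge; near: n; exact: (cvgr_lt _ uc).
- apply: nearW => x Dx n; rewrite normrM ler_piMl//.
  by rewrite normr_nat lern1 leq_b1.
Unshelve. all: by end_near. Qed.

Lemma Rintegrable_ae_bounded (f g : T -> R) : measurable_fun D f ->
  {ae mu, forall x, D x -> `|f x| <= g x} -> mu.-integrable D (EFin \o g) ->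
  mu.-integrable D (EFin \o f).
Proof.
move=> mf fg /integrable_norm ig; apply/integrableP; split.
  exact/measurable_EFinP.
have mg := measurable_int _ ig; apply: le_lt_trans (integrable_lty mD ig).
apply: ae_ge0_le_integral => //.
- by do 2 apply: measurableT_comp => //.
- by move=> x _; rewrite /= lee_fin.
- by apply: filterS fg => x h Dx; rewrite lee_fin (le_trans (h Dx))// ler_norm.
Qed.

Lemma Rintegrable_bounded (f g : T -> R) : measurable_fun D f ->
  (forall x, D x -> `|f x| <= g x) -> mu.-integrable D (EFin \o g) ->
  mu.-integrable D (EFin \o f).
Proof.
by move=> mf fg; apply: Rintegrable_ae_bounded => //; exact: nearW.
Qed.

Lemma ae_eq_Rintegral (f g : T -> R) : measurable_fun D f -> measurable_fun D g ->
  {ae mu, forall x, D x -> f x = g x} ->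
  \int[mu]_(x in D) f x = \int[mu]_(x in D) g x.
Proof.
move=> mf mg fg; congr fine; apply: ae_eq_integral => //.
- exact/measurable_EFinP.
- exact/measurable_EFinP.
- by apply: filterS fg => x h /h ->.
Qed.

Lemma RintegrableD (f g : T -> R) :
  mu.-integrable D (EFin \o f) -> mu.-integrable D (EFin \o g) ->
  mu.-integrable D (EFin \o (fun x => f x + g x)).
Proof. by move=> hf hg; exact: (integrableD mD hf hg). Qed.

Lemma RintegrableZ (c : R) (f : T -> R) :
  mu.-integrable D (EFin \o f) -> mu.-integrable D (EFin \o (fun x => c * f x)).
Proof. by move=> hf; exact: (integrableZl mD c hf). Qed.

End rintegral_complements.

(** * From the flux identity to the density *)

Lemma measurable_softmaxV (R : realType) (tau delta : R) : 0 < tau -> 0 < delta ->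
  measurable_fun setT (fun x => (softmax tau delta x)^-1).
Proof.
move=> ? d0; apply: continuous_measurable_fun => x; apply: cvgV.
  by rewrite gt_eqF// (lt_le_trans _ (softmax_ge _ _ _)).
exact: continuous_softmax.
Qed.

Lemma measurable_softmax_slope (R : realType) (tau delta : R) :
  0 < tau -> 0 < delta ->
  measurable_fun setT (fun x => softmax' tau delta x / softmax tau delta x ^+ 2).
Proof.
move=> ? d0; apply: measurable_funM.
  by apply: continuous_measurable_fun; exact: continuous_softmax'.
under eq_fun do rewrite -exprVn.
by apply: measurable_funX; exact: measurable_softmaxV.
Qed.

(* [V] is the varifold and [L] the Lebesgue measure, [w] the multiplicity on the
   enclosed region [E]; [t] and [u] are the squared distances to x0, [s] = <y, nu>
   and [k] = h - c0. *)
Section density.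
Context (R : realType).
Implicit Types tau delta : R.
Context d1 (T1 : measurableType d1) (V : {measure set T1 -> \bar R}).
Context d2 (T2 : measurableType d2) (L : {measure set T2 -> \bar R}).
Variables (t s k : T1 -> R) (T : R) (E : set T2) (u w : T2 -> R) (c : R).
Hypothesis Vfin : (V setT < +oo)%E.
Hypothesis mt : measurable_fun setT t.
Hypothesis ms : measurable_fun setT s.
Hypothesis mk : measurable_fun setT k.
Hypothesis st : forall x, s x ^+ 2 <= t x.
Hypothesis tT : {ae V, forall x, t x <= T}.
Hypothesis ik : V.-integrable setT (EFin \o (fun x => k x ^+ 2)).
Hypothesis mE : measurable E.
Hypothesis mu : measurable_fun E u.
Hypothesis mw : measurable_fun E w.
Hypothesis w0 : forall x, E x -> 0 <= w x.
Hypothesis uT : {ae L, forall x, E x -> 0 < u x <= T}.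
Hypothesis iwu : L.-integrable E (EFin \o (fun x => w x / u x)).

(** [a] is the profile of the radial test field and [b] is minus its derivative. In [flux], the
    terms with the factor 2 [a] come from the divergence along the plane, those with 3 [a] from the
    full divergence. *)
Let a tau delta x : R := (softmax tau delta x)^-1.
Let b tau delta x : R := softmax' tau delta x / softmax tau delta x ^+ 2.

Hypothesis flux : forall tau delta, 0 < tau -> 0 < delta ->
  \int[V]_x (2 * a tau delta (t x) - 2 * b tau delta (t x) * (t x - s x ^+ 2)
             + s x * k x * a tau delta (t x)) =
  c * \int[L]_(x in E)
        ((3 * a tau delta (u x) - 2 * b tau delta (u x) * u x) * w x).

Let t0 x : 0 <= t x. Proof. exact: le_trans (sqr_ge0 _) (st x). Qed.

Let ma tau delta : 0 < tau -> 0 < delta -> measurable_fun setT (a tau delta).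
Proof. exact: measurable_softmaxV. Qed.

Let mb tau delta : 0 < tau -> 0 < delta -> measurable_fun setT (b tau delta).
Proof. exact: measurable_softmax_slope. Qed.

Let a_ge0 tau delta x : 0 < tau -> 0 < delta -> 0 <= a tau delta x <= tau^-1.
Proof.
move=> p0 d0; have h := softmax_ge tau x d0.
by rewrite invr_ge0 lef_pV2 ?posrE ?h ?(le_trans (ltW p0))// (lt_le_trans p0).
Qed.

Let b_ge0 tau delta x : 0 < tau -> 0 < delta ->
  0 <= b tau delta x <= (tau ^+ 2)^-1.
Proof.
move=> p0 d0; have /andP[a0 a1] := a_ge0 x p0 d0.
have s0 := softmax'_ge0 tau x d0; have s1 := softmax'_le1 tau x d0.
have e : (softmax tau delta x ^+ 2)^-1 = a tau delta x ^+ 2 by rewrite -exprVn.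
rewrite /b e mulr_ge0 ?sqr_ge0//=.
rewrite (@le_trans _ _ (a tau delta x ^+ 2)) ?ler_piMl ?sqr_ge0//.
by rewrite -exprVn lerXn2r// ?nnegrE// invr_ge0 ltW.
Qed.

Let T_ge0 x : t x <= T -> 0 <= T. Proof. exact: le_trans. Qed.

Let s_le x : t x <= T -> `|s x| <= 1 + T.
Proof.
move=> tx; have T0 := T_ge0 tx; have := le_trans (st x) tx.
rewrite -real_normK ?num_real//; have := normr_ge0 (s x); nra.
Qed.

(** As V is finite, multiples of 1 + k^2 can dominate all integrands that are bounded combinations
    of 1, k and k^2. *)
Let ik1 : V.-integrable setT (EFin \o (fun x => 1 + k x ^+ 2)).
Proof.
have := integrableD _ (_ : V.-integrable setT (EFin \o cst 1)) ik; apply => //.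
apply: measurable_bounded_integrable => //.
exact: bounded_cst.
Qed.

Let k_le x : `|k x| <= 1 + k x ^+ 2.
Proof.
by rewrite -(real_normK (num_real (k x))); have := normr_ge0 (k x); nra.
Qed.

Let acvg tau x : 0 < tau -> a tau n.+1%:R^-1 x @[n --> \oo] --> (Num.max x tau)^-1.
Proof.
move=> p0; apply: cvgV; last exact: cvg_softmax.
by rewrite gt_eqF// lt_max p0 orbT.
Qed.

Let bcvg tau x : 0 < tau ->
  b tau n.+1%:R^-1 x @[n --> \oo] --> (tau < x)%R%:R / (Num.max x tau) ^+ 2.
Proof.
move=> p0; apply: cvgM; first exact: cvg_softmax'.
apply: cvgV; first by rewrite expf_neq0// gt_eqF// lt_max p0 orbT.
rewrite expr2; under eq_fun do rewrite expr2.
by apply: cvgM; exact: cvg_softmax.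
Qed.

Let mmax d (S : measurableType d) (D : set S) (f : S -> R) tau : 0 < tau ->
  measurable_fun D f -> measurable_fun D (fun x => (Num.max (f x) tau)^-1).
Proof.
move=> p0 mf; pose h (x : R) := (Num.max x tau)^-1.
rewrite -[X in measurable_fun _ X]/(h \o f); apply: measurableT_comp => //.
apply: continuous_measurable_fun => x; apply: cvgV.
  by rewrite gt_eqF// lt_max p0 orbT.
by apply: (@continuous_max _ R) => //; exact: cst_continuous.
Qed.

Let mltr d (S : measurableType d) (D : set S) (f : S -> R) tau :
  measurable D -> measurable_fun D f -> measurable_fun D (fun x => (tau < f x)%R%:R : R).
Proof.
move=> mD mf.
have -> : (fun x => (tau < f x)%R%:R : R) = (fun x => 1 - (f x <= tau)%R%:R).
  by apply/funext => x; rewrite ltNge; case: (_ <= _); rewrite /= ?subr0// subrr.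
by apply: measurable_funB => //; exact: measurable_fun_ler_natr.
Qed.

(** Both sides of [flux] at delta = 1/(n+1) converge by dominated convergence. The convergence of
    [a] and [b] holds at every point, so the mass of the sphere t = tau need not be discussed. *)
Lemma flux_limit tau : 0 < tau ->
  \int[V]_x (2 / Num.max (t x) tau
     - 2 * ((tau < t x)%R%:R / Num.max (t x) tau ^+ 2) * (t x - s x ^+ 2)
             + s x * k x / Num.max (t x) tau) =
  c * \int[L]_(x in E)
        ((3 / Num.max (u x) tau
          - 2 * ((tau < u x)%R%:R / Num.max (u x) tau ^+ 2) * u x) * w x).
Proof.
move=> p0.
pose F n := \int[V]_x (2 * a tau n.+1%:R^-1 (t x)
   - 2 * b tau n.+1%:R^-1 (t x) * (t x - s x ^+ 2)
             + s x * k x * a tau n.+1%:R^-1 (t x)).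
have h1 : F n @[n --> \oo] --> \int[V]_x (2 / Num.max (t x) tau
     - 2 * ((tau < t x)%R%:R / Num.max (t x) tau ^+ 2) * (t x - s x ^+ 2)
             + s x * k x / Num.max (t x) tau).
  (* The three constants bound the three summands where t <= T: a <= 1/tau; b <= 1/tau^2 with 0 <= t
     - s^2 <= T; |s| <= 1 + T together with |k| <= 1 + k^2. *)
  apply: (@dominated_convergence_Rintegral _ _ _ _ _ _ _ _
    (fun x => (2 / tau + 2 * T / tau ^+ 2 + (1 + T) / tau) * (1 + k x ^+ 2))) => //.
  - move=> n; apply: measurable_funD; [apply: measurable_funB|].
    + by apply: measurable_funM => //; apply: measurableT_comp => //; exact: ma.
    + apply: measurable_funM.
        by apply: measurable_funM => //; apply: measurableT_comp => //; exact: mb.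
      by apply: measurable_funB => //; exact: measurable_funX.
    + apply: measurable_funM; first exact: measurable_funM.
      by apply: measurableT_comp => //; exact: ma.
  - apply: measurable_funD; [apply: measurable_funB|].
    + by apply: measurable_funM => //; exact: mmax p0 _.
    + apply: measurable_funM.
        apply: measurable_funM => //; apply: measurable_funM; first exact: mltr.
        by under eq_fun do rewrite -exprVn; apply: measurable_funX; exact: mmax p0 _.
      by apply: measurable_funB => //; exact: measurable_funX.
    + by apply: measurable_funM; [exact: measurable_funM|exact: mmax p0 _].
  - exact: (@integrableZl _ _ _ V setT measurableT
      (2 / tau + 2 * T / tau ^+ 2 + (1 + T) / tau) _ ik1).
  - apply: nearW => x _; apply: cvgD; [apply: cvgB|].
    + by apply: cvgMr; exact: acvg.
    + apply: cvgMl; apply: cvgMr; exact: bcvg.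
    + by apply: cvgMr; exact: acvg.
  - apply: filterS tT => x tx _ n.
    have T0 := T_ge0 tx.
    have /andP[a0 a1] := @a_ge0 tau n.+1%:R^-1 (t x) p0 ltac:(by []).
    have /andP[b0 b1] := @b_ge0 tau n.+1%:R^-1 (t x) p0 ltac:(by []).
    move: a0 a1 b0 b1; move: (a _ _ _) (b _ _ _) => A B a0 a1 b0 b1.
    have kx := k_le x; have sx := s_le tx.
    have k1 : 1 <= 1 + k x ^+ 2 by rewrite lerDl sqr_ge0.
    have ts0 : 0 <= t x - s x ^+ 2 by rewrite subr_ge0.
    have tsT : t x - s x ^+ 2 <= T by have := sqr_ge0 (s x); lra.
    have i0 : 0 <= tau^-1 by rewrite invr_ge0 ltW.
    have i2 : 0 <= (tau ^+ 2)^-1 by rewrite invr_ge0 sqr_ge0.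
    apply: (le_trans (ler_normD _ _)); rewrite [leRHS]mulrDl; apply: lerD.
      rewrite -[leLHS]mulr1 ler_pM//.
      apply: (le_trans (ler_normB _ _)); apply: lerD.
        by rewrite ger0_norm ?mulr_ge0// ler_pM2l.
      rewrite ger0_norm; last by do 2 (apply: mulr_ge0 => //).
      rewrite [leRHS]mulrAC -!mulrA ler_pM2l//.
      by rewrite ler_pM//.
    rewrite !normrM (ger0_norm a0) mulrAC ler_pM// ?mulr_ge0//.
    by rewrite ler_pM//.
have h2 : c * \int[L]_(x in E)
        ((3 * a tau n.+1%:R^-1 (u x) - 2 * b tau n.+1%:R^-1 (u x) * u x) * w x) @[n --> \oo]
   -->   c * \int[L]_(x in E)
        ((3 / Num.max (u x) tau
          - 2 * ((tau < u x)%R%:R / Num.max (u x) tau ^+ 2) * u x) * w x).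
  (* Where 0 < u <= T the multiplicity satisfies w <= T (w / u), which brings in the integrable
     function w / u. *)
  apply: cvgMr; apply: (@dominated_convergence_Rintegral _ _ _ _ _ _ _ _
    (fun x => (3 / tau + 2 * T / tau ^+ 2) * T * (w x / u x))) => //.
  - move=> n; apply: measurable_funM => //; apply: measurable_funB.
    + by apply: measurable_funM => //; apply: measurableT_comp => //; exact: ma.
    + apply: measurable_funM => //.
      by apply: measurable_funM => //; apply: measurableT_comp => //; exact: mb.
  - apply: measurable_funM => //; apply: measurable_funB.
    + by apply: measurable_funM => //; exact: mmax p0 _.
    + apply: measurable_funM => //.
      apply: measurable_funM => //; apply: measurable_funM; first exact: mltr.
      by under eq_fun do rewrite -exprVn; apply: measurable_funX; exact: mmax p0 _.
  - exact: (@integrableZl _ _ _ L E mE ((3 / tau + 2 * T / tau ^+ 2) * T) _ iwu).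
  - apply: nearW => x _; apply: cvgMl; apply: cvgB.
    + by apply: cvgMr; exact: acvg.
    + by apply: cvgMl; apply: cvgMr; exact: bcvg.
  - apply: filterS uT => x ux Ex n; have /andP[u0 u1] := ux Ex.
    have /andP[a0 a1] := @a_ge0 tau n.+1%:R^-1 (u x) p0 ltac:(by []).
    have /andP[b0 b1] := @b_ge0 tau n.+1%:R^-1 (u x) p0 ltac:(by []).
    move: a0 a1 b0 b1; move: (a _ _ _) (b _ _ _) => A B a0 a1 b0 b1.
    have wx := w0 Ex; have T0 : 0 < T by exact: lt_le_trans u0 u1.
    have i0 : 0 <= tau^-1 by rewrite invr_ge0 ltW.
    have i2 : 0 <= (tau ^+ 2)^-1 by rewrite invr_ge0 sqr_ge0.
    rewrite normrM (ger0_norm wx) -[leRHS]mulrA ler_pM//; last first.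
      by rewrite mulrCA ler_peMr// ler_pdivlMr// mul1r.
    apply: (le_trans (ler_normB _ _)); apply: lerD.
      by rewrite ger0_norm ?mulr_ge0// ler_pM2l.
    rewrite ger0_norm; last by rewrite !mulr_ge0 ?(ltW u0).
    rewrite [leRHS]mulrAC -!mulrA ler_pM2l//.
    by rewrite ler_pM// (ltW u0).
have h3 : F = (fun n => c * \int[L]_(x in E)
        ((3 * a tau n.+1%:R^-1 (u x) - 2 * b tau n.+1%:R^-1 (u x) * u x) * w x)).
  by apply/funext => n; rewrite /F flux.
by rewrite h3 in h1; exact: (cvg_unique _ h1 h2).
Qed.

(** * The balance at a fixed scale *)

Let near_disk tau x : R := (t x <= tau)%R%:R.

(** For tau = r^2 this is [pi] times the density ratio at radius r. *)
Let m tau := (\int[V]_x near_disk tau x) / tau.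

Let kap tau := \int[V]_x (near_disk tau x * k x ^+ 2).

Let e tau := tau^-1 * \int[V]_x (near_disk tau x * (s x * k x)).

Let q tau x := (tau < t x)%R%:R * (2 * (s x / t x + k x / 4) ^+ 2).

Let G tau := \int[L]_(x in E)
  ((3 / Num.max (u x) tau
    - 2 * ((tau < u x)%R%:R / Num.max (u x) tau ^+ 2) * u x) * w x).

Let mn tau : measurable_fun setT (near_disk tau).
Proof. exact: measurable_fun_ler_natr. Qed.

Let in1 tau : V.-integrable setT (EFin \o near_disk tau).
Proof.
apply: (@Rintegrable_bounded _ _ _ _ _ _ _ (fun x => 1 + k x ^+ 2)) => //.
move=> x _; rewrite normr_nat (@le_trans _ _ 1)//; last by rewrite lerDl sqr_ge0.
by rewrite lern1 leq_b1.
Qed.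

Let s_le_disk tau x : 0 < tau -> t x <= tau -> `|s x| <= 1 + tau.
Proof.
move=> p0 tx; have := le_trans (st x) tx.
rewrite -real_normK ?num_real//; have := normr_ge0 (s x); nra.
Qed.

Let insk tau : 0 < tau ->
  V.-integrable setT (EFin \o (fun x => near_disk tau x * (s x * k x))).
Proof.
move=> p0; apply: (@Rintegrable_bounded _ _ _ _ _ _ _ (fun x => (1 + tau) * (1 + k x ^+ 2))) => //.
- by apply: measurable_funM => //; exact: measurable_funM.
- move=> x _; rewrite /near_disk; case: (leP (t x) tau) => tx; last first.
    by rewrite mulr0n mul0r normr0 mulr_ge0// addr_ge0 ?sqr_ge0// ltW.
  by rewrite mulr1n mul1r normrM ler_pM// s_le_disk.
- exact: (RintegrableZ measurableT (1 + tau) ik1).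
Qed.

Let ink tau : V.-integrable setT (EFin \o (fun x => near_disk tau x * k x ^+ 2)).
Proof.
apply: (@Rintegrable_bounded _ _ _ _ _ _ _ (fun x => k x ^+ 2)) => //.
- by apply: measurable_funM => //; exact: measurable_funX.
- move=> x _; rewrite ger0_norm; last by rewrite mulr_ge0 ?sqr_ge0// /near_disk ler0n.
  by rewrite ler_piMl ?sqr_ge0// /near_disk lern1 leq_b1.
Qed.

Let mq tau : 0 < tau -> measurable_fun setT (q tau).
Proof.
move=> p0.
(* Where the indicator is not 0, t exceeds tau and may be replaced by its maximum with tau, whose
   inverse is continuous in t. *)
have -> : q tau = fun x => (tau < t x)%R%:R * (2 * (s x / (Num.max (t x) tau) + k x / 4) ^+ 2).
  apply/funext => x; rewrite /q; case: (ltP tau (t x)) => tx; last by rewrite mulr0n !mul0r.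
  by [].
apply: measurable_funM; first exact: mltr.
apply: measurable_funM => //; apply: measurable_funX; apply: measurable_funD.
  by apply: measurable_funM => //; exact: mmax p0 _.
exact: measurable_funM.
Qed.

Let inq tau : 0 < tau -> V.-integrable setT (EFin \o q tau).
Proof.
(* For t > tau one has (s/t)^2 <= 1/t <= 1/tau, and 2 (p + r/4)^2 <= 4 p^2 + r^2/4. *)
move=> p0; apply: (@Rintegrable_bounded _ _ _ _ _ _ _
  (fun x => (4 / tau + 1) * (1 + k x ^+ 2))) => //.
- exact: mq.
- move=> x _; have i0 : 0 < tau^-1 by rewrite invr_gt0.
  rewrite /q; case: (ltP tau (t x)) => tx; last first.
    by rewrite mulr0n mul0r normr0 mulr_ge0// addr_ge0 ?sqr_ge0// mulr_ge0// ltW.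
  rewrite mulr1n mul1r ger0_norm; last by rewrite mulr_ge0// sqr_ge0.
  have tp : 0 < t x by exact: lt_trans tx.
  have h1 : (s x / t x) ^+ 2 <= tau^-1.
    rewrite expr_div_n ler_pdivrMr ?exprn_gt0//.
    apply: (le_trans (st x)); rewrite expr2 mulrA ler_peMl ?ltW//.
    by rewrite ltr_pdivlMl ?mulr1.
  have := sqr_ge0 (s x / t x - k x / 4); have := sqr_ge0 (k x).
  move: h1; set p := s x / t x; set r := k x; set z := tau^-1 in i0 *; nra.
- exact: (RintegrableZ measurableT (4 / tau + 1) ik1).
Qed.

Lemma flux_balance tau : 0 < tau ->
  2 * m tau + e tau + \int[V]_x q tau x - (\int[V]_x (k x ^+ 2)) / 8 + kap tau / 8 = c * G tau.
Proof.
move=> p0; rewrite /G -flux_limit//.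
(* The last two summands together are - k^2/8 for t > tau and 0 on the disk. In this form each
   summand is integrable over the whole space and has its own name in the balance. *)
transitivity (\int[V]_x (2 / tau * near_disk tau x
   + (tau^-1 * (near_disk tau x * (s x * k x)) + (q tau x
   + (- 8^-1 * k x ^+ 2 + 8^-1 * (near_disk tau x * k x ^+ 2)))))).
  have i1 := RintegrableZ measurableT (2 / tau) (in1 tau).
  have i2 := RintegrableZ measurableT tau^-1 (insk p0).
  have i3 := inq p0.
  have i4 := RintegrableZ measurableT (- 8^-1) ik.
  have i5 := RintegrableZ measurableT 8^-1 (ink tau).
  have i45 := RintegrableD measurableT i4 i5.
  have i345 := RintegrableD measurableT i3 i45.
  have i2345 := RintegrableD measurableT i2 i345.
  rewrite (RintegralD measurableT i1 i2345) (RintegralD measurableT i2 i345).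
  rewrite (RintegralD measurableT i3 i45) (RintegralD measurableT i4 i5).
  rewrite !RintegralZl//; last exact: insk.
  by rewrite /m /e /kap; field; lra.
apply: eq_Rintegral => x _; rewrite /q /near_disk.
case: (leP (t x) tau) => tx.
  rewrite mulr1n mulr0n !mul0r ?mulr0 !mul0r subr0 ?max_r//; field; lra.
have tp : 0 < t x by exact: lt_trans tx.
by rewrite mulr1n mulr0n ?max_l ?ltW//; field; lra.
Qed.

(** * Passage to scale zero *)

Let W := \int[L]_(x in E) (w x / u x).

Let K := \int[V]_x (k x ^+ 2).

Let cvgG : G tau @[tau --> 0^'+] --> W.
Proof.
apply/cvg_at_rightP => v [v0 vc].
(* For u > tau the integrand is exactly w / u; for u <= tau it is 3 w / tau, which is at most 3 w /
   u. The constant 5 covers both cases. *)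
apply: (@dominated_convergence_Rintegral _ _ _ _ _ _ _ _
    (fun x => 5 * (w x / u x))) => //.
- move=> n; apply: measurable_funM => //; apply: measurable_funB.
  + by apply: measurable_funM => //; exact: mmax (v0 n) _.
  + apply: measurable_funM => //.
    apply: measurable_funM => //; apply: measurable_funM; first exact: mltr.
    by under eq_fun do rewrite -exprVn; apply: measurable_funX; exact: mmax (v0 n) _.
- by apply/measurable_EFinP; exact: (measurable_int _ iwu).
- exact: (RintegrableZ mE 5 iwu).
- apply: filterS uT => x ux Ex; have /andP[u0 u1] := ux Ex.
  apply: cvg_near_cst; near=> n.
  have vu : v n < u x by near: n; exact: (cvgr_lt _ vc).
  by rewrite vu mulr1n max_l ?ltW//; field; lra.
- apply: filterS uT => x ux Ex n; have /andP[u0 u1] := ux Ex.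
  have wx := w0 Ex; have wu0 : 0 <= w x / u x by rewrite divr_ge0// ltW.
  have := v0 n; move: (v n) => z z0.
  case: (ltP z (u x)) => zu.
    rewrite mulr1n [X in `|X|](_ : _ = w x / u x); last by field; lra.
    by rewrite ger0_norm//; lra.
  rewrite mulr0n mul0r mulr0 mul0r subr0 ger0_norm; last first.
    by rewrite mulr_ge0// divr_ge0// ltW.
  have wzu : w x / z <= w x / u x by rewrite ler_wpM2l// lef_pV2.
  have -> : 3 / z * w x = 3 * (w x / z) by rewrite mulrAC mulrA.
  lra.
Unshelve. all: by end_near. Qed.

Let Q tau := \int[V]_x q tau x.

Let n0 tau x : 0 <= near_disk tau x.
Proof. by rewrite /near_disk ler0n. Qed.

Let m_ge0 tau : 0 < tau -> 0 <= m tau.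
Proof. by move=> p0; apply: divr_ge0; [exact: Rintegral_ge0|exact: ltW]. Qed.

Let kap_ge0 tau : 0 <= kap tau.
Proof. by apply: Rintegral_ge0 => x _; rewrite mulr_ge0 ?sqr_ge0. Qed.

Let kap_le tau : kap tau <= K.
Proof.
apply: le_Rintegral => // x _.
by rewrite ler_piMl ?sqr_ge0// /near_disk lern1 leq_b1.
Qed.

Let q_ge0 tau x : 0 <= q tau x.
Proof. by rewrite /q mulr_ge0 ?ler0n// mulr_ge0// sqr_ge0. Qed.

Let Q_ge0 tau : 0 <= Q tau.
Proof. by apply: Rintegral_ge0 => x _; exact: q_ge0. Qed.

Let Q_nincr tau1 tau2 : 0 < tau1 -> tau1 <= tau2 -> Q tau2 <= Q tau1.
Proof.
move=> p1 p12; apply: le_Rintegral => //; [exact/inq/(lt_le_trans p1)|exact: inq|].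
move=> x _; rewrite /q ler_wpM2r//; first by rewrite mulr_ge0// sqr_ge0.
rewrite ler_nat; case: (ltP tau2 (t x)) => // h.
by rewrite (le_lt_trans p12 h).
Qed.

(** On the disk s^2 <= tau, so (2 eps - |s| |k|)^2 >= 0 yields |s k| <= eps + tau k^2 / (4 eps).
    Integrating and dividing by tau turns the first term into eps times the area ratio. *)
Let e_le tau eps : 0 < tau -> 0 < eps ->
  `|e tau| <= eps * m tau + kap tau / (4 * eps).
Proof.
move=> p0 e0; rewrite /e normrM gtr0_norm ?invr_gt0//.
rewrite ler_pdivrMl// (le_trans (le_normr_Rintegral _ (insk p0)))//.
have -> : tau * (eps * m tau + kap tau / (4 * eps)) =
   \int[V]_x (eps * near_disk tau x + tau / (4 * eps) * (near_disk tau x * k x ^+ 2)).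
  have i1 := RintegrableZ measurableT eps (in1 tau).
  have i2 := RintegrableZ measurableT (tau / (4 * eps)) (ink tau).
  rewrite (RintegralD measurableT i1 i2) !RintegralZl//.
  by rewrite /m /kap; field; lra.
apply: le_Rintegral => //.
- exact: integrable_norm (insk p0).
- have i1 := RintegrableZ measurableT eps (in1 tau).
  have i2 := RintegrableZ measurableT (tau / (4 * eps)) (ink tau).
  exact: (RintegrableD measurableT i1 i2).
move=> x _; rewrite /near_disk; case: (leP (t x) tau) => tx; last first.
  by rewrite mulr0n !mul0r !mulr0 normr0 addr0.
rewrite mulr1n !mul1r mulr1 normrM.
have sx : `|s x| ^+ 2 <= tau by rewrite real_normK ?num_real// (le_trans (st x)).
rewrite -[k x ^+ 2]real_normK ?num_real//.
have h : 4 * eps * (`|s x| * `|k x|) <= 4 * eps * (eps + tau / (4 * eps) * `|k x| ^+ 2).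
  have -> : 4 * eps * (eps + tau / (4 * eps) * `|k x| ^+ 2) = 4 * eps ^+ 2 + tau * `|k x| ^+ 2.
    by field; lra.
  apply: (@le_trans _ _ (4 * eps ^+ 2 + `|s x| ^+ 2 * `|k x| ^+ 2)).
    have := sqr_ge0 (2 * eps - `|s x| * `|k x|); nra.
  by rewrite lerD2l ler_wpM2r// sqr_ge0.
by rewrite ler_pM2l ?mulr_gt0// in h.
Qed.

Let m_bounded : exists2 B, 0 <= B & \forall tau \near 0^'+, m tau <= B.
Proof.
(* |c W| + 1 bounds c G, K / 8 is the curvature term of the balance, and K / 4 bounds the
   contribution of [kap] in [e_le]. *)
exists (`|c * W| + 1 + K / 8 + K / 4).
  have : 0 <= K by apply: Rintegral_ge0 => x _; exact: sqr_ge0.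
  have := normr_ge0 (c * W); lra.
have cG : c * G tau @[tau --> 0^'+] --> c * W by apply: cvgMr; exact: cvgG.
near=> tau.
have p0 : 0 < tau by near: tau; exact: nbhs_right_gt.
have bal := flux_balance p0.
have h1 : c * G tau <= c * W + 1.
  by near: tau; apply: (cvgr_le _ cG); rewrite ltrDl.
have := @e_le tau 1 p0 ltr01; rewrite mul1r mulr1 => e1.
have := ler_norm (c * W); have := kap_le tau; have := kap_ge0 tau.
have := Q_ge0 tau; have := ler_norm (- e tau); rewrite normrN.
rewrite /Q /K in bal *; lra.
Unshelve. all: by end_near. Qed.

Let near_diskE r x : near_disk r x = \1_[set x | t x <= r] x.
Proof.
rewrite indicE (_ : (x \in [set x | t x <= r]) = (t x <= r))//.
by apply/idP/idP; rewrite inE.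
Qed.

Let measurable_sublevel r : measurable [set x | t x <= r].
Proof.
rewrite (_ : mkset _ = setT `&` t @^-1` `]-oo, r]%classic); first exact: mt.
by rewrite setTI; apply/seteqP; split => x /=; rewrite in_itv.
Qed.

(** A bounded area ratio excludes mass over x0: the mass of t <= 0 is at most that of t <= tau,
    hence at most B tau for all small tau. *)
Let null_center : V [set x | t x <= 0] = 0%E.
Proof.
have [B B0 mB] := m_bounded.
have VA (r : R) : V [set x | t x <= r] = (\int[V]_x near_disk r x)%:E.
  rewrite /Rintegral fineK; last exact: integrable_fin_num (in1 r).
  rewrite -[X in V X]setIT -integral_indic//.
  by apply: eq_integral => x _; rewrite -near_diskE.
rewrite VA; congr EFin; apply/eqP; rewrite eq_le Rintegral_ge0 ?andbT//.
rewrite leNgt; apply/negP => h.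
near (0 : R)^'+ => tau.
have p0 : 0 < tau by near: tau; exact: nbhs_right_gt.
have h2 : m tau <= B by near: tau.
have h3 : \int[V]_x near_disk 0 x <= \int[V]_x near_disk tau x.
  apply: le_Rintegral => // x _; rewrite /near_disk ler_nat.
  by case: (leP (t x) 0) => // ?; rewrite (@le_trans _ _ 0)// ltW.
rewrite /m ler_pdivrMr// in h2.
(* B may be 0, so B + 1 serves as the divisor in the choice of tau. *)
have h4 : (B + 1) * tau < \int[V]_x near_disk 0 x.
  rewrite mulrC -ltr_pdivlMr; last lra.
  by near: tau; apply: nbhs_right_lt; rewrite divr_gt0//; lra.
lra.
Unshelve. all: by end_near. Qed.

Let cvg_kap : kap tau @[tau --> 0^'+] --> (0 : R).
Proof.
apply: cvg_Rintegral_sublevel0 => //.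
exists [set x | t x <= 0]; split; [exact: measurable_sublevel|exact: null_center|].
by move=> x /= /not_implyP[_ /not_implyP[]].
Qed.

Let cvg_e : e tau @[tau --> 0^'+] --> (0 : R).
Proof.
have [B B0 mB] := m_bounded.
apply/cvgrPdist_le => eps e0; rewrite /=.
(* z is the weight in Young's inequality. It makes z m at most eps / 2, and only then is tau taken
   so small that kap / (4 z) is at most eps / 2 as well. *)
have [z z0 zE] : exists2 z, 0 < z & z * (B + 1) = eps / 2.
  exists (eps / (2 * (B + 1))); last by field; lra.
  by rewrite divr_gt0// mulr_gt0//; lra.
near=> tau; rewrite sub0r normrN.
have p0 : 0 < tau by near: tau; exact: nbhs_right_gt.
apply: (le_trans (e_le p0 z0)).
have h2 : m tau <= B by near: tau.
have h3 : kap tau <= 2 * z * eps.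
  by near: tau; apply: (cvgr_le _ cvg_kap); apply: mulr_gt0 => //; exact: mulr_gt0.
have h4 : kap tau / (4 * z) <= eps / 2.
  by rewrite ler_pdivrMr; [lra|exact: mulr_gt0].
have h5 : z * m tau <= eps / 2.
  by rewrite -zE ler_pM2l//; lra.
lra.
Unshelve. all: by end_near. Qed.

(** The integral of [q] grows as tau decreases, and the balance bounds it from above once the other
    terms are controlled. Its limit is not computed; only its sign matters later. *)
Let cvgQ : cvg (Q tau @[tau --> 0^'+]).
Proof.
have [B B0 mB] := m_bounded.
have cG : c * G tau @[tau --> 0^'+] --> c * W by apply: cvgMr; exact: cvgG.
have Qb : \forall tau \near 0^'+, Q tau <= c * W + 1 + K / 8 + 1.
  near=> tau.
  have p0 : 0 < tau by near: tau; exact: nbhs_right_gt.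
  have bal := flux_balance p0.
  have h1 : c * G tau <= c * W + 1.
    by near: tau; apply: (cvgr_le _ cG); rewrite ltrDl.
  have h2 : - 1 <= e tau.
    by near: tau; apply: (cvgr_ge _ cvg_e); rewrite oppr_lt0.
  have := m_ge0 p0; have := kap_ge0 tau; rewrite /Q /K in bal *; lra.
apply: nonincreasing_at_right_is_cvgr.
  near=> x => y z; rewrite !in_itv/= => /andP[y0 _] _; exact: Q_nincr.
have [r r0 hr] := Qb; near=> x.
exists (c * W + 1 + K / 8 + 1) => _ [y /= +] <-.
rewrite in_itv/= => /andP[y0 yx]; apply: hr => //=.
rewrite sub0r normrN gtr0_norm// (lt_trans yx)//.
Unshelve. all: by end_near. Qed.

(** The balance expresses [m] through terms that all converge. The inequality for the limit comes
    from discarding the nonnegative limit of the completed square. *)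
Lemma area_ratio_cvg : exists2 l, l <= K / 16 + c / 2 * W &
  (fine (V [set x | t x <= tau]) / tau) @[tau --> 0^'+] --> l.
Proof.
pose Q0 := lim (Q tau @[tau --> 0^'+]).
have Q00 : 0 <= Q0.
  by apply: limr_ge; [exact: cvgQ|near=> x; exact: Q_ge0].
(* The two zeros are the limits of [kap] and [e], left in place to match the shape of the
   balance. *)
exists ((c * W + K / 8 - 0 / 8 - 0 - Q0) / 2); first lra.
have h : (c * G tau + K / 8 - kap tau / 8 - e tau - Q tau) / 2 @[tau --> 0^'+] -->
    (c * W + K / 8 - 0 / 8 - 0 - Q0) / 2.
  apply: cvgMl; apply: cvgB; last exact: cvgQ.
  apply: cvgB; last exact: cvg_e.
  apply: cvgB; last by apply: cvgMl; exact: cvg_kap.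
  by apply: cvgD; [apply: cvgMr; exact: cvgG|exact: cvg_cst].
apply: cvg_trans h; apply: near_eq_cvg; near=> tau.
have p0 : 0 < tau by near: tau; exact: nbhs_right_gt.
have bal := flux_balance p0.
have -> : (c * G tau + K / 8 - kap tau / 8 - e tau - Q tau) / 2 = m tau.
  by rewrite /Q /K in bal *; lra.
rewrite /m /Rintegral; congr (fine _ / _).
rewrite -[X in V X]setIT -integral_indic//.
by apply: eq_integral => x _; rewrite -near_diskE.
Unshelve. all: by end_near. Qed.

End density.

(** * Linear algebra of the oriented planes *)

Section vdot_theory.
Context {R : realType}.
Implicit Types (u v w x y : R3 R).

Lemma vdotC u v : vdot u v = vdot v u.
Proof. by rewrite /vdot; ring. Qed.

Lemma vdotDr u v w : vdot u (v + w) = vdot u v + vdot u w.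
Proof. by rewrite /vdot /=; ring. Qed.

Lemma vdotZr (a : R) u v : vdot u (a *: v) = a * vdot u v.
Proof. by rewrite /vdot /= -![_ *: _]/(_ * _); ring. Qed.

Lemma vdotBr u v w : vdot u (v - w) = vdot u v - vdot u w.
Proof. by rewrite /vdot /=; ring. Qed.

Lemma vdotDl u v w : vdot (v + w) u = vdot v u + vdot w u.
Proof. by rewrite /vdot /=; ring. Qed.

Lemma vdotZl (a : R) u v : vdot (a *: v) u = a * vdot v u.
Proof. by rewrite /vdot /= -![_ *: _]/(_ * _); ring. Qed.

Lemma vdot_ge0 u : 0 <= vdot u u.
Proof. by rewrite /vdot -!expr2 !addr_ge0 ?sqr_ge0. Qed.

Lemma vdot_eq0 u : vdot u u = 0 -> u = 0.
Proof.
case: u => -[a b] c; rewrite /vdot /= => h.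
have a0 : a = 0 by nra.
have b0 : b = 0 by nra.
have c0 : c = 0 by nra.
by rewrite a0 b0 c0.
Qed.

Lemma vnorm_sqr u : vnorm u ^+ 2 = vdot u u.
Proof. by rewrite /vnorm sqr_sqrtr ?vdot_ge0. Qed.

Lemma vdot_cauchy u v : vdot u v ^+ 2 <= vdot u u * vdot v v.
Proof.
rewrite -subr_ge0.
have -> : vdot u u * vdot v v - vdot u v ^+ 2 = vdot (vwedge u v) (vwedge u v).
  by rewrite vdot_vwedge (vdotC v u) expr2.
exact: vdot_ge0.
Qed.

Lemma vdot_crossl u v : vdot u (vcross u v) = 0.
Proof. by rewrite /vdot /=; ring. Qed.

(* [vdot x (vcross n e) ^+ 2] is the Gram determinant of [x], [n], [e], so the
   difference of the two sides has length 0. *)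
Lemma orthonormal_expansion n e x : vdot n n = 1 -> vdot e e = 1 ->
  vdot n e = 0 ->
  x = vdot x n *: n + (vdot x e *: e + vdot x (vcross n e) *: vcross n e).
Proof.
move=> n1 e1 ne.
have c1 : vdot (vcross n e) (vcross n e) = 1.
  have -> : vdot (vcross n e) (vcross n e) = vdot n n * vdot e e - vdot n e ^+ 2.
    by rewrite /vdot /=; ring.
  by rewrite n1 e1 ne; ring.
have en : vdot e n = 0 by rewrite vdotC.
have nc : vdot n (vcross n e) = 0 by exact: vdot_crossl.
have ec : vdot e (vcross n e) = 0 by rewrite /vdot /=; ring.
have gram : vdot x (vcross n e) ^+ 2 = vdot x x - vdot x n ^+ 2 - vdot x e ^+ 2.
  have -> : vdot x (vcross n e) ^+ 2 =
      vdot x x * (vdot n n * vdot e e - vdot n e ^+ 2)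
      - vdot x n * (vdot x n * vdot e e - vdot n e * vdot x e)
      + vdot x e * (vdot x n * vdot n e - vdot n n * vdot x e).
    by rewrite /vdot /=; ring.
  by rewrite n1 e1 ne; ring.
move: gram c1 nc ec; move: (vcross n e) => c gram c1 nc ec.
have cn : vdot c n = 0 by rewrite vdotC.
have ce : vdot c e = 0 by rewrite vdotC.
apply/eqP; rewrite -subr_eq0; apply/eqP/vdot_eq0.
have nx : vdot n x = vdot x n by exact: vdotC.
have ex : vdot e x = vdot x e by exact: vdotC.
have cx : vdot c x = vdot x c by exact: vdotC.
rewrite -[x - _]addrC -scaleN1r.
rewrite !(vdotDl, vdotDr, vdotZl, vdotZr) n1 e1 ne en nc ec c1 cn ce nx ex cx.
have -> : vdot x x = vdot x c ^+ 2 + vdot x n ^+ 2 + vdot x e ^+ 2 by rewrite gram; ring.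
ring.
Qed.

Lemma vdot_star_tangent xi x : tangent xi x <-> vdot x (star xi) = 0.
Proof.
rewrite /tangent /= /wedge3 /vdot /=.
by split => h; rewrite -[RHS]h; ring.
Qed.

(** [divergence_along] takes its basis from [xget], so nothing is known about that choice until some
    basis exists. Here v is nonzero because its cross product with w has length 1; the basis is v /
    |v| and its cross product with the normal. *)
Lemma orthonormal_basis_exists v w : vdot (vcross v w) (vcross v w) = 1 ->
  exists e, orthonormal_basis (tangent (vwedge v w)) e.
Proof.
set n := vcross v w => n1.
have v0 : 0 < vdot v v.
  rewrite lt_neqAle vdot_ge0 andbT eq_sym; apply/eqP => /vdot_eq0 v0.
  move: n1; rewrite /n v0 /vcross /vdot /= !mul0r subrr !mul0r !addr0.
  by move/eqP; rewrite eq_sym oner_eq0.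
pose e := (vnorm v)^-1 *: v.
have nv0 : vnorm v != 0 by rewrite /vnorm sqrtr_eq0 -ltNge.
have e1 : vdot e e = 1.
  by rewrite vdotZl vdotZr -vnorm_sqr; field.
have ne : vdot n e = 0.
  by rewrite vdotZr vdotC /n vdot_crossl mulr0.
clearbody e.
have nc : vdot n (vcross n e) = 0 by exact: vdot_crossl.
have c1 : vdot (vcross n e) (vcross n e) = 1.
  have -> : vdot (vcross n e) (vcross n e) = vdot n n * vdot e e - vdot n e ^+ 2.
    by rewrite /vdot /=; ring.
  by rewrite n1 e1 ne; ring.
exists (e, vcross n e); split => //=; first by rewrite /vdot /=; ring.
apply/seteqP; split => x.
  move/vdot_star_tangent; rewrite star_vwedge -/n => xn.
  have := orthonormal_expansion x n1 e1 ne; rewrite xn scale0r add0r => xE.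
  by exists (vdot x e) => //; exists (vdot x (vcross n e)).
move=> [a _ [b _ <-]]; apply/vdot_star_tangent; rewrite star_vwedge -/n.
by rewrite vdotDl !vdotZl (vdotC e) ne (vdotC _ n) nc !mulr0 addr0.
Qed.

(** The left side is the squared length of the projection y - <y, n> n. Since the right side does
    not mention the basis, the arbitrary choice in [divergence_along] becomes harmless. *)
Lemma orthonormal_basis_pythagoras xi e y : vdot (star xi) (star xi) = 1 ->
  orthonormal_basis (tangent xi) e ->
  vdot e.1 y ^+ 2 + vdot e.2 y ^+ 2 = vdot y y - vdot y (star xi) ^+ 2.
Proof.
set n := star xi => n1 [e1 e2 e12 T].
have te1 : vdot e.1 n = 0.
  apply/vdot_star_tangent; rewrite T; exists 1 => //; exists 0 => //.
  by rewrite scale1r scale0r addr0.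
have te2 : vdot e.2 n = 0.
  apply/vdot_star_tangent; rewrite T; exists 0 => //; exists 1 => //.
  by rewrite scale1r scale0r add0r.
have : tangent xi (y - vdot y n *: n).
  by apply/vdot_star_tangent; rewrite -scaleN1r vdotDl !vdotZl n1; ring.
rewrite T => -[a _ [b _ /eqP]]; rewrite eq_sym subr_eq => /eqP yE.
have e21 : vdot e.2 e.1 = 0 by rewrite vdotC.
have tn1 : vdot n e.1 = 0 by rewrite vdotC.
have tn2 : vdot n e.2 = 0 by rewrite vdotC.
move: (vdot y n) yE => c ->.
rewrite !(vdotDl, vdotDr, vdotZl, vdotZr) n1 e1 e2 te1 te2 e12 e21 tn1 tn2.
by ring.
Qed.

(** Lagrange's identity turns a vanishing wedge product into |h|^2 = <h, n>^2, so h - <h, n> n has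
    length 0. *)
Lemma parallel_of_vwedge0 (h n : R3 R) : vdot n n = 1 -> vwedge h n = 0 ->
  h = vdot h n *: n.
Proof.
move=> n1 w0; apply/eqP; rewrite -subr_eq0; apply/eqP/vdot_eq0.
have w2 : vdot (vwedge h n) (vwedge h n) = 0 by rewrite w0 /vdot /=; ring.
rewrite vdot_vwedge n1 in w2.
rewrite -scaleN1r !(vdotDl, vdotDr, vdotZl, vdotZr) n1 (vdotC n h).
rewrite (vdotC n h) in w2.
have -> : vdot h h = vdot h n * vdot h n by lra.
by ring.
Qed.

End vdot_theory.

(** * Radial vector fields *)

Section coordinates.
Context {R : realType}.

Lemma continuous_fst (U V : normedModType R) : continuous (@fst U V).
Proof. by move=> x; exact: cvg_fst. Qed.

Lemma continuous_snd (U V : normedModType R) : continuous (@snd U V).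
Proof. by move=> x; exact: cvg_snd. Qed.

Lemma is_diff_fst (U V : normedModType R) (x : U * V) : is_diff x fst fst.
Proof.
apply: DiffDef; first exact/linear_differentiable/continuous_fst.
exact/diff_lin/continuous_fst.
Qed.

Lemma is_diff_snd (U V : normedModType R) (x : U * V) : is_diff x snd snd.
Proof.
apply: DiffDef; first exact/linear_differentiable/continuous_snd.
exact/diff_lin/continuous_snd.
Qed.

Lemma continuous_vdot (T : topologicalType) (f g : T -> R3 R) (x : T) :
  {for x, continuous f} -> {for x, continuous g} ->
  {for x, continuous (fun y => vdot (f y) (g y))}.
Proof.
move=> cf cg.
have cfst (U W : normedModType R) (h : T -> U * W) :
    {for x, continuous h} -> {for x, continuous (fun y => (h y).1)}.
  move=> ch; apply: (@continuous_comp _ _ _ h fst); first exact: ch.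
  exact: continuous_fst.
have csnd (U W : normedModType R) (h : T -> U * W) :
    {for x, continuous h} -> {for x, continuous (fun y => (h y).2)}.
  move=> ch; apply: (@continuous_comp _ _ _ h snd); first exact: ch.
  exact: continuous_snd.
have [cf1 cg1] := (cfst _ _ _ cf, cfst _ _ _ cg).
apply: cvgD; first apply: cvgD.
- by apply: cvgM; [exact: cfst cf1|exact: cfst cg1].
- by apply: cvgM; [exact: csnd cf1|exact: csnd cg1].
- by apply: cvgM; [exact: csnd cf|exact: csnd cg].
Qed.

Lemma continuous_sqdist (x0 : R3 R) : continuous (fun x : R3 R => vdot (x - x0) (x - x0)).
Proof.
move=> x.
have cB : {for x, continuous (fun y : R3 R => y - x0)}.
  by apply: cvgB; [exact: cvg_id|exact: cvg_cst].
exact: (continuous_vdot cB cB).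
Qed.

Lemma continuous_vdot_sub (x0 v : R3 R) : continuous (fun x : R3 R => vdot (x - x0) v).
Proof.
move=> x.
have cB : {for x, continuous (fun y : R3 R => y - x0)}.
  by apply: cvgB; [exact: cvg_id|exact: cvg_cst].
have cv : {for x, continuous (fun _ : R3 R => v)} by exact: cvg_cst.
exact: (continuous_vdot cB cv).
Qed.

(** The mean value theorem along the segment from a to b. The real-valued form suffices because the
    sup norm lets a vector field be treated coordinate by coordinate. *)
Lemma mean_value_lipschitz (V : normedModType R) (F : V -> R) (dF : V -> V -> R) C :
  (forall x, is_diff x F (dF x)) -> (forall x v, `|dF x v| <= C * `|v|) ->
  forall a b, `|F b - F a| <= C * `|b - a|.
Proof.
move=> hF hC a b.
pose l (s : R) : V := s *: (b - a) + a.
have dl (s : R) : is_diff s l ( *:%R^~ (b - a)).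
  have h1 : is_diff s (fun s : R => s *: (b - a)) ( *:%R^~ (b - a)).
    exact: is_diff_scalel.
  have h2 := @is_diff_cst _ R V a s.
  by apply: (is_diff_eq (is_diffD h1 h2)); rewrite addr0.
have dFl (s : R) : is_derive s 1 (F \o l) (dF (l s) (b - a)).
  have [h1 h2] := is_diff_comp (dl s) (hF (l s)).
  apply: DeriveDef; first exact: diff_derivable.
  by rewrite deriveE// h2/= scale1r.
have cFl : {within `[0, 1], continuous (F \o l)}.
  apply: continuous_subspaceT => s; apply: differentiable_continuous.
  by apply/derivable1_diffP; have [] := dFl s.
have [c _] := MVT ltr01 (fun s _ => dFl s) cFl.
by rewrite /= /l scale1r scale0r subrK add0r subr0 mulr1 => ->; exact: hC.
Qed.

Lemma compact_sqball (x0 : R3 R) (r : R) :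
  compact [set x | vdot (x - x0) (x - x0) <= r].
Proof.
(* Any d with d^2 <= r satisfies |d| <= 1 + |r|, which avoids square roots and any assumption on the
   sign of r. *)
pose I (a : R) := `[a - (1 + `|r|), a + (1 + `|r|)]%classic.
apply: (@subclosed_compact _ _ ((I x0.1.1 `*` I x0.1.2) `*` I x0.2)).
- have -> : [set x | vdot (x - x0) (x - x0) <= r] =
      (fun x => vdot (x - x0) (x - x0)) @^-1` [set y | y <= r] by [].
  apply: preimage_closed; last exact: closed_le.
  by move=> x _; exact: continuous_sqdist.
- by apply: compact_setX; [apply: compact_setX|]; exact: segment_compact.
move=> [[a b] c]; rewrite /vdot /I /= !in_itv/= => h.
have bnd (d p : R) : d * d + p <= r -> 0 <= p -> `|d| <= 1 + `|r|.
  move=> dr p0; have := ler_norm r; have : `|d| * `|d| = d * d.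
    by rewrite -normrM ger0_norm// -expr2 sqr_ge0.
  have := normr_ge0 d; nra.
have [a2 b2 c2] : [/\ 0 <= (a - x0.1.1) * (a - x0.1.1),
    0 <= (b - x0.1.2) * (b - x0.1.2) & 0 <= (c - x0.2) * (c - x0.2)].
  by rewrite -!expr2 !sqr_ge0.
do ![split].
- rewrite -ler_distl.
  by apply: (bnd _ ((b - x0.1.2) * (b - x0.1.2) + (c - x0.2) * (c - x0.2))); lra.
- rewrite -ler_distl.
  by apply: (bnd _ ((a - x0.1.1) * (a - x0.1.1) + (c - x0.2) * (c - x0.2))); lra.
- rewrite -ler_distl.
  by apply: (bnd _ ((a - x0.1.1) * (a - x0.1.1) + (b - x0.1.2) * (b - x0.1.2))); lra.
Qed.

End coordinates.

Section radial_field.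
Context {R : realType}.
Variables (phi phi' : R -> R) (T A B : R) (x0 : R3 R).
Hypothesis dphi : forall t : R, is_derive t 1 phi (phi' t).
Hypothesis cphi' : continuous phi'.
Hypothesis phi0 : forall t, T <= t -> phi t = 0.
Hypothesis phi_le : forall t, 0 <= t -> `|phi t| <= A.
Hypothesis phi'_le : forall t, 0 <= t -> `|phi' t| * t <= B.

Definition radial_field (x : R3 R) : R3 R :=
  phi (vdot (x - x0) (x - x0)) *: (x - x0).

Definition radial_derivative (x v : R3 R) : R3 R :=
  phi (vdot (x - x0) (x - x0)) *: v
  + (2 * phi' (vdot (x - x0) (x - x0)) * vdot (x - x0) v) *: (x - x0).

Let is_diff_coord1 (x : R3 R) : is_diff x (fun y => y.1.1 - x0.1.1) (fun y => y.1.1).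
Proof.
have h1 := is_diff_fst x; have h2 := is_diff_fst x.1.
have h : is_diff x (fst \o fst : R3 R -> R) (fst \o fst) by exact: is_diff_comp.
have hc := @is_diff_cst _ (R3 R) R (- x0.1.1) x.
by have := is_diffD h hc; rewrite addr0.
Qed.

Let is_diff_coord2 (x : R3 R) : is_diff x (fun y => y.1.2 - x0.1.2) (fun y => y.1.2).
Proof.
have h1 := is_diff_fst x; have h2 := is_diff_snd x.1.
have h : is_diff x (snd \o fst : R3 R -> R) (snd \o fst) by exact: is_diff_comp.
have hc := @is_diff_cst _ (R3 R) R (- x0.1.2) x.
by have := is_diffD h hc; rewrite addr0.
Qed.

Let is_diff_coord3 (x : R3 R) : is_diff x (fun y => y.2 - x0.2) (fun y => y.2).
Proof.
have h := is_diff_snd x.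
have hc := @is_diff_cst _ (R3 R) R (- x0.2) x.
by have := is_diffD h hc; rewrite addr0.
Qed.

Let sqdist (x : R3 R) := vdot (x - x0) (x - x0).

Let is_diff_sqdist (x : R3 R) : is_diff x sqdist (fun v => 2 * vdot (x - x0) v).
Proof.
have h1 := is_diff_coord1 x; have h2 := is_diff_coord2 x; have h3 := is_diff_coord3 x.
apply: (is_diff_eq (is_diffD (is_diffD (is_diffM h1 h1) (is_diffM h2 h2)) (is_diffM h3 h3))).
apply/funext => v.
rewrite /vdot /= !fctE -![_ *: _]/(_ * _); ring.
Qed.

Let is_diff_phi (x : R3 R) :
  is_diff x (phi \o sqdist) (fun v => 2 * phi' (sqdist x) * vdot (x - x0) v).
Proof.
have [h1 h2] := dphi (sqdist x).
have hd : is_diff (sqdist x) phi (fun v => phi' (sqdist x) * v).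
  apply: DiffDef; first exact/derivable1_diffP.
  by rewrite (deriv1E h1) derive1E h2; apply/funext => v; rewrite mulrC.
apply: (is_diff_eq (is_diff_comp (is_diff_sqdist x) hd)).
by apply/funext => v /=; ring.
Qed.

Lemma is_diff_radial_field x : is_diff x radial_field (radial_derivative x).
Proof.
have h1 := is_diffM (is_diff_phi x) (is_diff_coord1 x).
have h2 := is_diffM (is_diff_phi x) (is_diff_coord2 x).
have h3 := is_diffM (is_diff_phi x) (is_diff_coord3 x).
have -> : radial_field = (fun y => ((((phi \o sqdist) * (fun y : R3 R => y.1.1 - x0.1.1)) y,
  ((phi \o sqdist) * (fun y : R3 R => y.1.2 - x0.1.2)) y),
  ((phi \o sqdist) * (fun y : R3 R => y.2 - x0.2)) y)).
  by apply/funext => y.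
apply: (is_diff_eq (is_diff_pair (is_diff_pair h1 h2) h3)); apply/funext => v.
rewrite /radial_derivative /= !fctE -/(sqdist x).
by congr ((_, _), _); rewrite /= -![_ *: _]/(_ * _); ring.
Qed.

Lemma derive_radial_field x v : 'D_v radial_field x = radial_derivative x v.
Proof. by have [h e] := is_diff_radial_field x; rewrite deriveE// e. Qed.

Lemma divergence_radial_field x : divergence radial_field x =
  3 * phi (sqdist x) + 2 * phi' (sqdist x) * sqdist x.
Proof.
rewrite /divergence !derive_radial_field /radial_derivative -/(sqdist x) /=.
by rewrite -![_ *: _]/(_ * _) [in RHS]/sqdist /vdot /=; ring.
Qed.

(** With y = x - x0, the differential is phi times the identity plus 2 phi' times the tensor square
    of y. Its trace over the plane is 2 phi + 2 phi' times the squared length of the tangential part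
    of y. *)
Lemma divergence_along_radial_field v w x :
  vdot (vcross v w) (vcross v w) = 1 ->
  divergence_along (tangent (vwedge v w)) radial_field x =
  2 * phi (sqdist x) + 2 * phi' (sqdist x) *
    (sqdist x - vdot (x - x0) (vcross v w) ^+ 2).
Proof.
move=> n1; rewrite /divergence_along.
have := orthonormal_basis_exists n1 => -[e0 eb].
have := @xgetPex _ (0, 0) (orthonormal_basis (tangent (vwedge v w))).
move=> /(_ (ex_intro _ _ eb)); move: (xget _ _) => e eB.
rewrite !derive_radial_field /radial_derivative -/(sqdist x) !vdotDr !vdotZr.
have := @orthonormal_basis_pythagoras _ (vwedge v w) e (x - x0).
rewrite star_vwedge => /(_ n1 eB) <-.
have [-> -> _ _] := eB.
by rewrite !(vdotC _ (x - x0)); ring.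
Qed.

Lemma C1_radial_field : C1 radial_field.
Proof.
have csq : continuous sqdist.
  by move=> x; apply: differentiable_continuous; have [] := is_diff_sqdist x.
split => [x|v x]; first by have [] := is_diff_radial_field x.
rewrite (_ : (fun x => _) = (fun x => radial_derivative x v)); last first.
  by apply/funext => y; exact: derive_radial_field.
have cB : (fun y : R3 R => y - x0) y @[y --> x] --> x - x0.
  by apply: cvgB; [exact: cvg_id|exact: cvg_cst].
apply: cvgD.
  apply: cvgZr_tmp.
  by apply: differentiable_continuous; have [] := is_diff_phi x.
apply: cvgZ => //; apply: cvgM; first apply: cvgM; first exact: cvg_cst.
  by apply: continuous_comp; [exact: csq|exact: cphi'].
exact: continuous_vdot_sub.
Qed.

Lemma compactly_supported_radial_field : compactly_supported radial_field.
Proof.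
have cK := @compact_sqball _ x0 T.
apply: (subclosed_compact _ cK); first exact: closed_closure.
rewrite closureE; apply: smallest_sub; first exact: compact_closed cK.
move=> x /=; apply: contra_neqP => /negP; rewrite -ltNge => h.
by rewrite /radial_field phi0 ?scale0r// ltW.
Qed.

Let norm_coord (v : R3 R) : [/\ `|v.1.1| <= `|v|, `|v.1.2| <= `|v| & `|v.2| <= `|v|].
Proof. by rewrite !prod_normE !le_max !lexx !orbT. Qed.

(** The differential contains phi' times two factors of length |y|, which is why |phi'(t)| t has to
    be bounded. The 6 is the factor 2 times the three coordinate products in the scalar product,
    each at most |y|^2 |v| for the sup norm of v. *)
Let radial_derivative_bound (x v : R3 R) (d p : R) : `|d| <= `|v| ->
  p * p <= sqdist x ->
  `|phi (sqdist x) * d + 2 * phi' (sqdist x) * vdot (x - x0) v * p| <= (A + 6 * B) * `|v|.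
Proof.
move=> dv py; have [n1 n2 n3] := norm_coord v.
have q0 : 0 <= sqdist x by exact: vdot_ge0.
have hA := phi_le q0; have hB := phi'_le q0.
have N0 : 0 <= `|v| by [].
have amgm (z : R) : z * z <= sqdist x -> `|z| * `|p| <= sqdist x.
  have zz : `|z| * `|z| = z * z by rewrite -normrM ger0_norm// -expr2 sqr_ge0.
  have pp : `|p| * `|p| = p * p by rewrite -normrM ger0_norm// -expr2 sqr_ge0.
  have := sqr_ge0 (`|z| - `|p|); nra.
have key : `|vdot (x - x0) v * p| <= 3 * sqdist x * `|v|.
  have -> : vdot (x - x0) v * p = (x - x0).1.1 * v.1.1 * p
      + (x - x0).1.2 * v.1.2 * p + (x - x0).2 * v.2 * p.
    by rewrite /vdot; ring.
  apply: (le_trans (ler_normD _ _)).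
  have -> : 3 * sqdist x * `|v| = (sqdist x * `|v| + sqdist x * `|v|) + sqdist x * `|v| by ring.
  have b3 (z w : R) : z * z <= sqdist x -> `|w| <= `|v| -> `|z * w * p| <= sqdist x * `|v|.
    by move=> hz hw; rewrite mulrAC !normrM ler_pM// ?mulr_ge0// amgm.
  have s1 := sqr_ge0 (x - x0).1.1; have s2 := sqr_ge0 (x - x0).1.2.
  have s3 := sqr_ge0 (x - x0).2.
  apply: lerD; last by apply: b3 => //; rewrite /sqdist/vdot; lra.
  apply: (le_trans (ler_normD _ _)); apply: lerD.
    by apply: b3 => //; rewrite /sqdist /vdot; lra.
  by apply: b3 => //; rewrite /sqdist /vdot; lra.
apply: (le_trans (ler_normD _ _)); rewrite [leRHS]mulrDl; apply: lerD.
  by rewrite normrM ler_pM.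
rewrite -mulrA normrM normrM ger0_norm//.
apply: (@le_trans _ _ (2 * `|phi' (sqdist x)| * (3 * sqdist x * `|v|))).
  by rewrite ler_wpM2l// mulr_ge0.
have -> : 2 * `|phi' (sqdist x)| * (3 * sqdist x * `|v|) =
    6 * (`|phi' (sqdist x)| * sqdist x) * `|v|.
  by ring.
by rewrite ler_wpM2r// ler_wpM2l.
Qed.

Lemma lipschitz_radial_field : lipschitz radial_field.
Proof.
apply: (@klipschitzW _ _ _ (A + 6 * B)).
  exact: (@globally_properfilter _ _ (x0, x0)).
move=> [a b] _ /=.
have d1 x : is_diff x (fun y => (radial_field y).1.1) (fun v => (radial_derivative x v).1.1).
  have h := is_diff_comp (is_diff_radial_field x) (is_diff_fst (radial_field x)).
  exact: (is_diff_comp h (is_diff_fst (radial_field x).1)).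
have d2 x : is_diff x (fun y => (radial_field y).1.2) (fun v => (radial_derivative x v).1.2).
  have h := is_diff_comp (is_diff_radial_field x) (is_diff_fst (radial_field x)).
  exact: (is_diff_comp h (is_diff_snd (radial_field x).1)).
have d3 x : is_diff x (fun y => (radial_field y).2) (fun v => (radial_derivative x v).2).
  exact: (is_diff_comp (is_diff_radial_field x) (is_diff_snd (radial_field x))).
have sq (x : R3 R) : [/\ (x - x0).1.1 * (x - x0).1.1 <= sqdist x,
    (x - x0).1.2 * (x - x0).1.2 <= sqdist x & (x - x0).2 * (x - x0).2 <= sqdist x].
  have s1 := sqr_ge0 (x - x0).1.1; have s2 := sqr_ge0 (x - x0).1.2.
  have s3 := sqr_ge0 (x - x0).2.
  by rewrite /sqdist /vdot; split; lra.
have b1 x v : `|(radial_derivative x v).1.1| <= (A + 6 * B) * `|v|.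
  by apply: radial_derivative_bound; [have [] := norm_coord v|have [] := sq x].
have b2 x v : `|(radial_derivative x v).1.2| <= (A + 6 * B) * `|v|.
  by apply: radial_derivative_bound; [have [] := norm_coord v|have [] := sq x].
have b3 x v : `|(radial_derivative x v).2| <= (A + 6 * B) * `|v|.
  by apply: radial_derivative_bound; [have [] := norm_coord v|have [] := sq x].
rewrite prod_normE /= prod_normE /= !ge_max.
rewrite (mean_value_lipschitz d1 b1) (mean_value_lipschitz d2 b2).
by rewrite (mean_value_lipschitz d3 b3).
Qed.

End radial_field.

(** * Topology and measurability *)

Section oriented_planes.
Context {R : realType}.

(** In dimension three every 2-vector factors, as the two explicit cases show. The oriented
    Grassmannian is therefore the whole unit sphere, which is closed. *)
Lemma oriented_planesE (xi : bivector R) : vdot xi xi = 1 -> oriented_planes xi.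
Proof.
move=> xi1; split; last by rewrite /vnorm xi1 sqrtr1.
case: xi {xi1} => -[a b] c.
have [->|a0] := eqVneq a 0.
  by exists (b, c, 0), (0, 0, 1); rewrite /vwedge /=; congr ((_, _), _); ring.
by exists (1, 0, - c / a), (0, a, b); rewrite /vwedge /=; congr ((_, _), _); field.
Qed.

Lemma G32_norm (xi : G32 R) : vdot (biv xi) (biv xi) = 1.
Proof.
have : oriented_planes (biv xi) by rewrite /biv; exact: set_mem (valP xi).
by move=> [_ h]; rewrite -vnorm_sqr h expr1n.
Qed.

Lemma G32_simple (xi : G32 R) : exists v w, biv xi = vwedge v w.
Proof.
have : oriented_planes (biv xi) by rewrite /biv; exact: set_mem (valP xi).
by case.
Qed.

Lemma G32_star_norm (xi : G32 R) : vdot (star (biv xi)) (star (biv xi)) = 1.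
Proof. by rewrite -(G32_norm xi) /star /vdot /=; ring. Qed.

Lemma continuous_biv : continuous (@biv R).
Proof. exact: initial_continuous. Qed.

(** A filter on the subtype is pushed to the unit sphere and clusters there. The cluster point lifts
    back because the open sets of the subtype are the traces of the ambient ones. *)
Lemma compact_G32 : compact [set: G32 R].
Proof.
have cS : compact [set xi : bivector R | vdot xi xi = 1].
  apply: (subclosed_compact _ (@compact_sqball R 0 1)).
    have -> : [set xi : bivector R | vdot xi xi = 1] =
        (fun x => vdot (x - 0) (x - 0)) @^-1` [set 1].
      by apply/funext => x /=; rewrite subr0.
    by apply: preimage_closed => //; move=> x _; exact: continuous_sqdist.
  by move=> x /= h; rewrite subr0 h.
move=> F FF _.
have [|p [/= p1 Fp]] := cS (fmap (@biv R) F).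
  rewrite /fmap/=; apply: (@filterS _ F _ setT) => [x _|]; [exact: (G32_norm x)|exact: filterT].
have pS : p \in @oriented_planes R by rewrite inE; exact: oriented_planesE.
exists (SigSub pS : G32 R); split => // B U FB.
rewrite nbhsE => -[U' [[W oW WU'] U'p] U'U].
have pW : nbhs p W by apply: open_nbhs_nbhs; split => //; move: U'p; rewrite -WU'.
have FB' : (fmap (@biv R) F) (@biv R @` B).
  by rewrite /fmap/=; apply: filterS FB => x Bx; exists x.
have [q [[x Bx xq] Wq]] := Fp _ _ FB' pW.
by exists x; split => //; apply: U'U; rewrite -WU' /=; move: Wq; rewrite -xq.
Qed.

Lemma continuous_G32_measurable (f : G32 R -> R) :
  continuous f -> measurable_fun [set: G32 R] f.
Proof.
move=> /continuousP cf; apply: (measurability _ (RGenOpens.measurableE R)).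
move=> _ [_ [a [b ->] <-]]; rewrite setTI; apply: sub_sigma_algebra.
exact/cf/interval_open.
Qed.

End oriented_planes.

(** * A countable base and measurability on R^3 *)

Section borel_R3.
Context {R : realType}.

Lemma ball_rat (z r : R) : 0 < r -> exists q : rat, ball (ratr q : R) r z.
Proof.
move=> r0; have zz : z - r < z + r by lra.
have [q] := rat_in_itvoo zz; rewrite in_itv/= => /andP[q1 q2]; exists q.
by rewrite /ball/= ltr_norml; apply/andP; split; lra.
Qed.

(** A countable base of the topology made of product sets. It serves twice: open sets become
    measurable for the product sigma-algebra, and complements of supports get countable null
    covers. *)
Definition ratbox (i : rat * rat * rat * nat) : set (R3 R) :=
  (ball (ratr i.1.1.1 : R) i.2.+1%:R^-1 `*` ball (ratr i.1.1.2 : R) i.2.+1%:R^-1)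
  `*` ball (ratr i.1.2 : R) i.2.+1%:R^-1.

Lemma measurable_ratbox i : measurable (ratbox i).
Proof. by apply: measurableX; [apply: measurableX|]; exact: measurable_ball. Qed.

Lemma ratbox_basis (U : set (R3 R)) x : open U -> U x ->
  exists2 i, ratbox i x & ratbox i `<=` U.
Proof.
move=> oU Ux; have /nbhs_ballP [e /= e0 xe] : nbhs x U by apply: open_nbhs_nbhs.
have e20 : 0 < e / 2 by rewrite divr_gt0.
have [n _ hn] := near_infty_natSinv_lt (PosNum e20).
have {}hn := hn n (leqnn n).
have n0 : 0 < n.+1%:R^-1 :> R by [].
have [q1 h1] := ball_rat x.1.1 n0; have [q2 h2] := ball_rat x.1.2 n0.
have [q3 h3] := ball_rat x.2 n0.
exists ((q1, q2, q3), n) => // y [[y1 y2] y3]; apply: xe.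
have tri (q z w : R) : ball q n.+1%:R^-1 z -> ball q n.+1%:R^-1 w -> ball z e w.
  move=> hz hw; apply: (@le_ball _ _ z (n.+1%:R^-1 + n.+1%:R^-1)).
    by rewrite [leRHS]splitr lerD// ltW.
  by apply: (@ball_triangle _ _ q) => //; exact: ball_sym.
by split; [split|]; [exact: tri h1 y1|exact: tri h2 y2|exact: tri h3 y3].
Qed.

Lemma open_measurable_R3 (U : set (R3 R)) : open U -> measurable U.
Proof.
move=> oU.
have -> : U = \bigcup_i (if pselect (ratbox i `<=` U) then ratbox i else set0).
  apply/seteqP; split => x; last first.
    by move=> [i _]; case: pselect => // h; exact: h.
  move=> Ux; have [i ix iU] := ratbox_basis oU Ux.
  by exists i => //; case: pselect.
apply: countable_bigcupT_measurable; first exact: countableP.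
move=> i; case: pselect => /= h; last exact: measurable0.
exact: measurable_ratbox.
Qed.

(** A point off the support has a null open neighbourhood and hence lies in a null box, and there
    are only countably many boxes. The statement is about a plain set function so that it applies
    both to [weight V] and to the restriction of [lebesgue3] to E. *)
Lemma spt_null_cover (mu : set (R3 R) -> \bar R) : mu set0 = 0%E ->
  (forall A, measurable A -> (0 <= mu A)%E) ->
  (forall A B, measurable A -> measurable B -> A `<=` B -> (mu A <= mu B)%E) ->
  exists F : nat -> set (R3 R), [/\ forall n, measurable (F n),
    forall n, mu (F n) = 0%E & ~` spt mu `<=` \bigcup_n F n].
Proof.
move=> mu0 mu_ge0 le_mu.
pose F n := if unpickle n is Some i then
  (if pselect (mu (ratbox i) = 0%E) then ratbox i else set0) else set0.
exists F; split.
- move=> n; rewrite /F; case: unpickle => [i|]; last exact: measurable0.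
  by case: pselect => /= h; [exact: measurable_ratbox|exact: measurable0].
- by move=> n; rewrite /F; case: unpickle => [i|//]; case: pselect.
move=> x /existsNP[U /not_implyP[[oU Ux] /negP]]; rewrite -leNgt => U0.
have [i ix iU] := ratbox_basis oU Ux.
suff mui : mu (ratbox i) = 0%E.
  by exists (pickle i); [exact: I|rewrite /F pickleK; case: pselect].
apply/eqP; rewrite eq_le mu_ge0 ?andbT; last exact: measurable_ratbox.
apply: le_trans U0; apply: le_mu => //; first exact: measurable_ratbox.
exact: open_measurable_R3.
Qed.

Lemma continuous_R3_measurable (f : R3 R -> R) :
  continuous f -> measurable_fun [set: R3 R] f.
Proof.
move=> /continuousP cf; apply: (measurability _ (RGenOpens.measurableE R)).
move=> _ [_ [a [b ->] <-]]; rewrite setTI; apply: open_measurable_R3.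
exact/cf/interval_open.
Qed.

Lemma measurable_fun_coord d (S : measurableType d) (D : set S) (f : S -> R3 R) :
  measurable D -> measurable_fun D f ->
  [/\ measurable_fun D (fun x => (f x).1.1), measurable_fun D (fun x => (f x).1.2) &
      measurable_fun D (fun x => (f x).2)].
Proof.
move=> mD mf.
have m1 : measurable_fun D (fun x => (f x).1).
  by apply: (measurableT_comp measurable_fst mf).
by split; [exact: (measurableT_comp measurable_fst m1)|
  exact: (measurableT_comp measurable_snd m1)|exact: (measurableT_comp measurable_snd mf)].
Qed.

Lemma measurable_fun_R3 d (S : measurableType d) (f g h : S -> R) :
  measurable_fun setT f -> measurable_fun setT g -> measurable_fun setT h ->
  measurable_fun setT (fun x => (f x, g x, h x) : R3 R).
Proof.
move=> mf mg mh.
exact: (measurable_fun_pair (measurable_fun_pair mf mg) mh).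
Qed.

Lemma measurable_fun_vdot d (S : measurableType d) (D : set S) (f g : S -> R3 R) :
  measurable D -> measurable_fun D f -> measurable_fun D g ->
  measurable_fun D (fun x => vdot (f x) (g x)).
Proof.
move=> mD mf mg; have [f1 f2 f3] := measurable_fun_coord mD mf.
have [g1 g2 g3] := measurable_fun_coord mD mg.
apply: measurable_funD; first apply: measurable_funD; exact: measurable_funM.
Qed.

Lemma measurable_star_biv : measurable_fun [set: G32 R] (fun xi => star (biv xi)).
Proof.
have c1 : continuous (fun xi : G32 R => (biv xi).1).
  move=> xi; apply: (@continuous_comp _ _ _ (@biv R) fst); first exact: continuous_biv.
  exact: continuous_fst.
apply: measurable_fun_R3.
- apply: continuous_G32_measurable => xi.
  by apply: (@continuous_comp _ _ _ (@biv R) snd); [exact: continuous_biv|exact: continuous_snd].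
- apply: measurable_funN; apply: continuous_G32_measurable => xi.
  apply: (@continuous_comp _ _ _ (fun xi : G32 R => (biv xi).1) snd); first exact: c1.
  exact: continuous_snd.
- apply: continuous_G32_measurable => xi.
  apply: (@continuous_comp _ _ _ (fun xi : G32 R => (biv xi).1) fst); first exact: c1.
  exact: continuous_fst.
Qed.

End borel_R3.

(** * Lebesgue measure on R^3 *)

Section lebesgue3_theory.
Context {R : realType}.

Lemma borel_lebesgue_measurable (A : set (R3 R)) :
  measurable A -> measurable (A : set (@lebesgue_R3 R)).
Proof.
move=> mA.
exact: (@caratheodory_measurable_mu_ext _ R _
  ((@lebesgue_measure R \x @lebesgue_measure R) \x @lebesgue_measure R)%E _ mA).
Qed.

Lemma borel_lebesgue_measurable_fun (f : R3 R -> R) :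
  measurable_fun [set: R3 R] f ->
  measurable_fun [set: @lebesgue_R3 R] (f : @lebesgue_R3 R -> R).
Proof.
move=> mf _ B mB; apply: borel_lebesgue_measurable; exact: mf.
Qed.

Lemma set1_R3_setX (x : R3 R) : [set x] = ([set x.1.1] `*` [set x.1.2]) `*` [set x.2].
Proof.
apply/seteqP; split => [y -> //|[[a b] c] [[/= -> ->] ->]].
by case: x => -[].
Qed.

Lemma measurable_set1_R3 (x : R3 R) : measurable [set x].
Proof. by rewrite set1_R3_setX; apply: measurableX => //; exact: measurableX. Qed.

Lemma lebesgue3_set1 (x : R3 R) : lebesgue3 [set x] = 0%E.
Proof.
have m1 : measurable ([set x.1.1] `*` [set x.1.2]) by exact: measurableX.
have m2 : measurable (([set x.1.1] `*` [set x.1.2]) `*` [set x.2]) by exact: measurableX.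
pose mu := ((@lebesgue_measure R \x @lebesgue_measure R) \x @lebesgue_measure R)%E.
transitivity (mu (([set x.1.1] `*` [set x.1.2]) `*` [set x.2])).
  rewrite set1_R3_setX; exact: (@measurable_mu_extE _ R _ mu _ m2).
transitivity ((@lebesgue_measure R \x @lebesgue_measure R) ([set x.1.1] `*` [set x.1.2])
    * @lebesgue_measure R [set x.2])%E.
  exact: product_measure1E.
by rewrite lebesgue_measure_set1 mule0.
Qed.

End lebesgue3_theory.

(** * The cutoff *)

(** The profile is 1 / softmax times a C^1 cutoff that is 1 up to T and 0 from T + 1 on. With T
    bounding the squared distances on the support and on E, the cutoff changes neither identity. The
    bounds A and B are those from which the field is shown to be Lipschitz. *)
Lemma cutoff_profile (R : realType) (tau delta T : R) : 0 < tau -> 0 < delta ->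
  exists phi phi' : R -> R,
  [/\ forall t : R, is_derive t 1 phi (phi' t), continuous phi',
      forall t, T + 1 <= t -> phi t = 0,
      exists A B, (forall t, 0 <= t -> `|phi t| <= A) /\
                  (forall t, 0 <= t -> `|phi' t| * t <= B) &
      forall t, t <= T -> phi t = (softmax tau delta t)^-1 /\
        phi' t = - (softmax' tau delta t / softmax tau delta t ^+ 2)].
Proof.
move=> p0 d0.
pose g (t : R) := pospart (t - T).
(* The inner square makes the cutoff leave 1 in a C^1 way at T, the outer one makes it reach 0 in a
   C^1 way at T + 1. *)
pose chi (t : R) := pospart (1 - g t ^+ 2) ^+ 2.
pose chi' (t : R) := - (4 * g t * pospart (1 - g t ^+ 2)).
have M0 t : 0 < softmax tau delta t by exact: lt_le_trans p0 (softmax_ge _ _ d0).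
have dg2 (t : R) : is_derive t 1 (fun u => g u ^+ 2) (2 * g t).
  have h1 : is_derive t 1 (fun u => u - T) (1 : R).
    by apply: is_derive_eq; rewrite subr0.
  have := @is_derive1_comp _ (fun u => pospart u ^+ 2) (fun u => u - T) t _ _
    (is_derive_pospart_sqr (t - T)) h1.
  by rewrite mulr1.
have dchi (t : R) : is_derive t 1 chi (chi' t).
  have h1 : is_derive t 1 (fun u => 1 - g u ^+ 2) (- (2 * g t)).
    have := is_deriveB (is_derive_cst (1 : R) t 1) (dg2 t).
    by rewrite sub0r.
  have h2 := @is_derive1_comp _ (fun u => pospart u ^+ 2) (fun u => 1 - g u ^+ 2) t _ _
    (is_derive_pospart_sqr _) h1.
  by apply: (is_derive_eq h2); rewrite /chi'; ring.
pose iM (t : R) := (softmax tau delta t)^-1.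
have diM (t : R) : is_derive t 1 iM (- (softmax' tau delta t / softmax tau delta t ^+ 2)).
  have [h1 h2] := is_derive_softmax tau t d0.
  have n0 : softmax tau delta t != 0 by rewrite gt_eqF.
  apply: DeriveDef; first exact: derivableV.
  by rewrite deriveV// h2 -[_ *: _]/(_ * _) mulNr mulrC.
have cg : continuous g.
  move=> x; apply: (@continuous_comp _ _ _ (fun u => u - T) pospart);
    last exact: continuous_pospart.
  by apply: cvgB; [exact: cvg_id|exact: cvg_cst].
have cpg : continuous (fun t => pospart (1 - g t ^+ 2)).
  move=> x; apply: (@continuous_comp _ _ _ (fun u => 1 - g u ^+ 2) pospart);
    last exact: continuous_pospart.
  apply: cvgB; first exact: cvg_cst.
  by rewrite expr2; under eq_fun do rewrite expr2; apply: cvgM; exact: cg.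
exists (fun t => chi t * iM t).
exists (fun t => chi t * (- (softmax' tau delta t / softmax tau delta t ^+ 2)) + iM t * chi' t).
have g0 t : 0 <= g t by exact: pospart_ge0.
have chi01 t : 0 <= chi t <= 1.
  rewrite /chi sqr_ge0/= expr_le1 ?pospart_ge0//.
  have := sqr_ge0 (g t); rewrite /pospart; case: (ltrP (1 - g t ^+ 2) 0); lra.
have chi'b t : `|chi' t| <= 4.
  rewrite normrN ger0_norm; last by rewrite !mulr_ge0// pospart_ge0.
  rewrite -mulrA ler_piMr//; have := g0 t; have := sqr_ge0 (g t).
  rewrite /pospart; case: (ltrP (1 - g t ^+ 2) 0); nra.
have far t : T + 1 <= t -> pospart (1 - g t ^+ 2) = 0.
  by move=> tT; rewrite pospart_eq0// /g pospart_id; nra.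
have iMb t : 0 <= iM t <= tau^-1.
  by rewrite invr_ge0 ltW//= lef_pV2 ?posrE//; exact: softmax_ge.
split.
- move=> t; apply: (is_derive_eq (is_deriveM (dchi t) (diM t))).
  by rewrite -![_ *: _]/(_ * _).
- move=> x; apply: cvgD; apply: cvgM.
  + rewrite /chi expr2; under eq_fun do rewrite expr2; apply: cvgM; exact: cpg.
  + apply: cvgN; apply: cvgM; first exact: continuous_softmax'.
    apply: cvgV; first by rewrite expf_neq0// gt_eqF.
    by rewrite expr2; under eq_fun do rewrite expr2; apply: cvgM; exact: continuous_softmax.
  + by apply: cvgV; [rewrite gt_eqF|exact: continuous_softmax].
  + by apply: cvgN; apply: cvgM; [apply: cvgMr; exact: cg|exact: cpg].
- by move=> t tT; rewrite /chi far// expr0n mul0r.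
(* The profile is at most 1/tau. In its derivative, the slope of 1 / softmax is at most 1/tau^2 and
   the slope of the cutoff at most 4; both terms vanish for t >= T + 1, and otherwise t <= |T| +
   1. *)
- exists tau^-1, ((tau ^+ 2)^-1 * (`|T| + 1) + tau^-1 * 4 * (`|T| + 1)); split => t t0.
    have /andP[i0 i1] := iMb t; have /andP[c0 c1] := chi01 t.
    by rewrite /= normrM !ger0_norm// -[leRHS]mul1r ler_pM.
  have [tT|/ltW tT] := leP t (T + 1); last first.
    rewrite /chi /chi' far// expr0n !mulr0 oppr0 mulr0 mul0r addr0 normr0 mul0r.
    have i0 : 0 <= tau^-1 by rewrite invr_ge0 ltW.
    have i2 : 0 <= (tau ^+ 2)^-1 by rewrite invr_ge0 sqr_ge0.
    have aT : 0 <= `|T| + 1 by rewrite addr_ge0.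
    by apply: addr_ge0; apply: mulr_ge0 => //; exact: mulr_ge0.
  have tT' : t <= `|T| + 1 by rewrite (le_trans tT)// lerD2r ler_norm.
  have /andP[i0 i1] := iMb t; have /andP[c0 c1] := chi01 t.
  apply: (@le_trans _ _ (((tau ^+ 2)^-1 + tau^-1 * 4) * (`|T| + 1))); last by rewrite mulrDl.
  rewrite ler_pM// (le_trans (ler_normD _ _))//; apply: lerD.
    rewrite normrM normrN -[leRHS]mul1r ler_pM//; first by rewrite ger0_norm.
    have s0 := softmax'_ge0 tau t d0; have s1 := softmax'_le1 tau t d0.
    rewrite ger0_norm; last by rewrite divr_ge0// sqr_ge0.
    rewrite -[leRHS]mul1r ler_pM ?invr_ge0 ?sqr_ge0//.
    by rewrite -exprVn -[leRHS]exprVn lerXn2r ?nnegrE ?(le_trans i0 i1).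
  by rewrite normrM ger0_norm// ler_pM.
move=> t tT; have gt0 : g t = 0 by rewrite /g pospart_eq0//; lra.
rewrite /chi /chi' gt0 expr0n subr0 pospart_id// expr1n.
by split; [rewrite mul1r|rewrite mulr0 mul0r oppr0 mulr0 addr0 mul1r].
Qed.

(** * Supports *)

Notation leb3 R := (lebesgue3 : {measure set (@lebesgue_R3 R) -> \bar R}).

Section supports.
Context {R : realType}.
Implicit Types V : {measure set (R3 R * G32 R) -> \bar R}.

Lemma weight_spt_ae V : {ae V, forall p, spt (weight V) p.1}.
Proof.
have mfst A : measurable A -> measurable (fst @^-1` A : set (R3 R * G32 R)).
  by move=> mA; rewrite -[X in measurable X]setTI; exact: measurable_fst.
have [|A mA|A B mA mB AB|F [mF F0 sF]] := @spt_null_cover R (weight V).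
- by rewrite /weight /pushforward preimage_set0 measure0.
- by rewrite /weight /pushforward; exact: (measure_ge0 V).
- rewrite /weight /pushforward; apply: (le_measure V); rewrite ?inE.
  + exact: (mfst _ mA).
  + exact: (mfst _ mB).
  + by move=> p; exact: AB.
have neg : V.-negligible (\bigcup_n (fst @^-1` F n)).
  apply: negligible_bigcup => n; exists (fst @^-1` F n); split => //.
    exact: mfst.
  exact: F0.
by apply: negligibleS neg => p /sF [n _ Fn]; exists n.
Qed.

Lemma lebesgue_spt_ae (E : set (R3 R)) : measurable (E : set (@lebesgue_R3 R)) ->
  {ae (leb3 R), forall x, E x -> spt (fun A => lebesgue3 (A `&` E)) x}.
Proof.
move=> mE.
have mI A : measurable A -> measurable (A `&` E : set (@lebesgue_R3 R)).
  by move=> mA; apply: measurableI => //; exact: borel_lebesgue_measurable.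
have [|A mA|A B mA mB AB|F [mF F0 sF]] :=
    @spt_null_cover R (fun A => lebesgue3 (A `&` E)).
- by rewrite set0I measure0.
- exact: (measure_ge0 (@lebesgue3 R)).
- apply: (le_measure (@lebesgue3 R)); rewrite ?inE.
  + exact: (mI _ mA).
  + exact: (mI _ mB).
  + exact: setSI.
have neg : (@lebesgue3 R).-negligible (\bigcup_n (F n `&` E)).
  apply: negligible_bigcup => n; exists (F n `&` E); split => //.
    exact: mI.
  exact: F0.
by apply: negligibleS neg => x /= /not_implyP[Ex /sF [n _ Fn]]; exists n.
Qed.

Lemma compact_sqdist_bounded (K : set (R3 R)) (x0 : R3 R) : compact K ->
  exists2 r, 0 <= r & forall x, K x -> vdot (x - x0) (x - x0) <= r.
Proof.
move=> cK.
have := @continuous_compact _ _ (fun x : R3 R => vdot (x - x0) (x - x0)) K.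
move=> /(_ (continuous_subspaceT (@continuous_sqdist R x0)) cK) /compact_bounded.
move=> [M [_ hM]]; exists (`|M| + 1) => [|x Kx]; first by rewrite addr_ge0.
apply: le_trans (ler_norm _) _; apply: hM; last by exists x.
by rewrite (le_lt_trans (ler_norm _))// ltrDl.
Qed.

(** V is finite on compact sets and lives, up to a null set, over its bounded support; a closed ball
    times the compact fibre [G32] is compact. *)
Lemma oriented_varifold_finite V : oriented_varifold V ->
  compact (spt (weight V)) -> (V setT < +oo)%E.
Proof.
move=> hV cK; have [r r0 hr] := compact_sqdist_bounded 0 cK.
pose B := [set x : R3 R | vdot (x - 0) (x - 0) <= r].
have cB : compact B by exact: compact_sqball.
have mB : measurable (B `*` [set: G32 R]).
  apply: measurableX => //.
  rewrite (_ : B = setT `&` (fun x : R3 R => vdot (x - 0) (x - 0)) @^-1` `]-oo, r]%classic).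
    exact: (continuous_R3_measurable (@continuous_sqdist R 0)).
  by rewrite setTI; apply/seteqP; split => x /=; rewrite in_itv.
have [N [mN N0 sN]] := weight_spt_ae V.
apply: (@le_lt_trans _ _ (V (B `*` [set: G32 R] `|` N))).
  apply: le_measure; rewrite ?inE //; first exact: measurableU.
  move=> p _; have [h|h] := pselect (spt (weight V) p.1); last by right; exact: sN.
  by left; split => //; exact: hr.
have Ny : (V N < +oo)%E by rewrite N0.
apply: (le_lt_trans (measureU2 V mB mN)); apply: lte_add_pinfty; last exact: Ny.
by apply: hV; apply: compact_setX => //; exact: compact_G32.
Qed.

Lemma bounded_of_diam (A : set (R3 R)) (x0 : R3 R) (d : R) : (diam A <= d%:E)%E ->
  exists r, forall x, A x -> vdot (x - x0) (x - x0) <= r.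
Proof.
move=> Ad; have [[z Az]|A0] := pselect (A !=set0); last first.
  by exists 0 => x Ax; exfalso; apply: A0; exists x.
(* From |a + b|^2 <= 2 |a|^2 + 2 |b|^2 with a = x - z and b = z - x0. *)
exists (2 * d ^+ 2 + 2 * vdot (z - x0) (z - x0)) => x Ax.
have h : (vnorm (x - z) <= d)%R.
  rewrite -lee_fin; apply: le_trans Ad; rewrite /diam le_max; apply/orP; right.
  by apply: ereal_sup_ubound; exists x => //; exists z.
have h2 : vdot (x - z) (x - z) <= d ^+ 2.
  by rewrite -vnorm_sqr lerXn2r// nnegrE ?sqrtr_ge0// (le_trans _ h) ?sqrtr_ge0.
have -> : x - x0 = (x - z) + (z - x0) by rewrite addrA subrK.
move: (x - z) (z - x0) h2 => a b h2.
have := vdot_ge0 (a - b); rewrite !vdotBr -scaleN1r !vdotDl !vdotZl !vdotDr.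
rewrite (vdotC b a); lra.
Qed.

(** Distances satisfy d^2 <= 4 r, hence d <= 1 + 4 r without a square root. Only the finiteness of
    the bound matters. *)
Lemma diam_bounded (A : set (R3 R)) (x0 : R3 R) (r : R) : 0 <= r ->
  (forall x, A x -> vdot (x - x0) (x - x0) <= r) -> (diam A <= (1 + 4 * r)%:E)%E.
Proof.
move=> r0 hA; rewrite /diam ge_max lee_fin addr_ge0 ?mulr_ge0//=.
apply: ge_ereal_sup => _ [x Ax [y Ay <-]]; rewrite lee_fin.
have : vnorm (x - y) ^+ 2 <= 4 * r.
  rewrite vnorm_sqr; have := hA _ Ax; have := hA _ Ay.
  have -> : x - y = (x - x0) - (y - x0) by rewrite opprB addrA subrK.
  move: (x - x0) (y - x0) => a b hb ha.
  have := vdot_ge0 (a + b); rewrite -scaleN1r !vdotDl !vdotDr !vdotZl !vdotZr.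
  rewrite (vdotC b a); lra.
have : 0 <= vnorm (x - y) by rewrite /vnorm sqrtr_ge0.
nra.
Qed.

(** This is where the diameter condition enters: the support of Lebesgue measure on E has finite
    diameter because that of the weight is compact, and almost every point of E lies in that
    support. *)
Lemma enclosed_region_bounded V H (E : set (R3 R)) Theta (x0 : R3 R) :
  enclosed_volume V H E Theta -> compact (spt (weight V)) ->
  exists r, {ae (leb3 R), forall x, E x -> vdot (x - x0) (x - x0) <= r}.
Proof.
move=> VHE cK; have [r r0 hr] := compact_sqdist_bounded x0 cK.
have [q hq] := bounded_of_diam x0 (le_trans (ev_diam VHE) (diam_bounded r0 hr)).
exists q; apply: negligibleS (lebesgue_spt_ae (ev_E_measurable VHE)) => x /=.
by apply: contra_not => h Ex; apply: hq; exact: h.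
Qed.

End supports.

(** * The flux identity *)

Lemma measurable_radial_divergence (R : realType) d (S : measurableType d)
    (D : set S) (f g : R -> R) (u w : S -> R) :
  measurable_fun setT f -> measurable_fun setT g ->
  measurable_fun D u -> measurable_fun D w ->
  measurable_fun D (fun x => (3 * f (u x) + 2 * g (u x) * u x) * w x).
Proof.
move=> mf mg mu mw; apply: measurable_funM => //; apply: measurable_funD.
  by apply: measurable_funM => //; exact: (measurableT_comp mf mu).
by do 2 apply: measurable_funM => //; exact: (measurableT_comp mg mu).
Qed.

Section flux_identity.
Context {R : realType}.
Variables (V : {measure set (R3 R * G32 R) -> \bar R}) (H : R3 R -> R3 R).
Variables (E : set (R3 R)) (Theta : R3 R -> nat) (x0 : R3 R) (c0 T : R).
Hypothesis VHE : enclosed_volume V H E Theta.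
Hypothesis Vfin : (V setT < +oo)%E.

Let sqd (x : R3 R) : R := vdot (x - x0) (x - x0).
Let n (p : R3 R * G32 R) : R3 R := star (biv p.2).
Let t (p : R3 R * G32 R) : R := sqd p.1.
Let s (p : R3 R * G32 R) : R := vdot (p.1 - x0) (n p).
Let h (p : R3 R * G32 R) : R := vdot (H p.1) (n p).
Let k (p : R3 R * G32 R) : R := h p - c0.

Hypothesis tT : {ae V, forall p, t p <= T}.
Hypothesis uT : {ae (leb3 R), forall x, E x -> sqd x <= T}.
Hypothesis ik : V.-integrable setT (EFin \o (fun p => k p ^+ 2)).

Lemma measurable_sub_center : measurable_fun [set: R3 R] (fun x : R3 R => x - x0).
Proof.
have [m1 m2 m3] := measurable_fun_coord measurableT (@measurable_id _ (R3 R) setT).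
have -> : (fun x : R3 R => x - x0) =
    (fun x => (x.1.1 - x0.1.1, x.1.2 - x0.1.2, x.2 - x0.2)) by [].
apply: measurable_fun_R3.
- exact: measurable_funB.
- exact: measurable_funB.
- exact: measurable_funB.
Qed.

Let my : measurable_fun [set: R3 R * G32 R] (fun p => p.1 - x0).
Proof. exact: (measurableT_comp measurable_sub_center measurable_fst). Qed.

Let mn : measurable_fun [set: R3 R * G32 R] n.
Proof. exact: (measurableT_comp measurable_star_biv measurable_snd). Qed.

Let mH : measurable_fun [set: R3 R * G32 R] (fun p => H p.1).
Proof. exact: (measurableT_comp (ev_H_measurable VHE) measurable_fst). Qed.

Lemma measurable_sqdist : measurable_fun setT sqd.
Proof. exact: continuous_R3_measurable (@continuous_sqdist R x0). Qed.

Lemma measurable_sqdist_fst : measurable_fun setT t.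
Proof. exact: (measurable_fun_vdot measurableT my my). Qed.

Lemma measurable_normal_component : measurable_fun setT s.
Proof. exact: (measurable_fun_vdot measurableT my mn). Qed.

Let mh : measurable_fun setT h.
Proof. exact: (measurable_fun_vdot measurableT mH mn). Qed.

Lemma measurable_curvature_excess : measurable_fun setT k.
Proof. by apply: measurable_funB => //; exact: mh. Qed.

Lemma normal_component_sqr_le p : s p ^+ 2 <= t p.
Proof.
have := vdot_cauchy (p.1 - x0) (n p).
by rewrite G32_star_norm mulr1.
Qed.

Lemma mean_curvature_normal : {ae V, forall p, H p.1 = h p *: n p}.
Proof.
apply: filterS (ev_H_normal VHE) => p.
exact: parallel_of_vwedge0 (G32_star_norm _).
Qed.

Let t_ge0 p : 0 <= t p. Proof. exact: vdot_ge0. Qed.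

Lemma measurable_fun_natr (f : R3 R -> nat) (D : set (@lebesgue_R3 R)) :
  measurable_fun D (f : @lebesgue_R3 R -> nat) ->
  measurable_fun D (fun x : @lebesgue_R3 R => (f x)%:R : R).
Proof.
move=> mf; have mnat : measurable_fun [set: nat] (fun i => i%:R : R) by [].
exact: (measurableT_comp mnat mf).
Qed.

Section radial_test_field.
Variables (phi phi' : R -> R) (A B : R).
Hypothesis dphi : forall t : R, is_derive t 1 phi (phi' t).
Hypothesis cphi' : continuous phi'.
Hypothesis phi0 : forall t, T + 1 <= t -> phi t = 0.
Hypothesis phi_le : forall t, 0 <= t -> `|phi t| <= A.
Hypothesis phi'_le : forall t, 0 <= t -> `|phi' t| * t <= B.

Let X := radial_field phi x0.

Let mphi : measurable_fun setT phi.
Proof.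
apply: continuous_measurable_fun => x; apply: differentiable_continuous.
by apply/derivable1_diffP; have [] := dphi x.
Qed.

Let mphi' : measurable_fun setT phi'.
Proof. exact: continuous_measurable_fun. Qed.

Let mphit : measurable_fun setT (fun p => phi (t p)).
Proof. exact: (measurableT_comp mphi measurable_sqdist_fst). Qed.

Let ik1 (c : R) : V.-integrable setT (EFin \o (fun p => c * (1 + k p ^+ 2))).
Proof.
apply: RintegrableZ => //; apply: RintegrableD => //.
apply: measurable_bounded_integrable => //; exact: bounded_cst.
Qed.

Let A0 : 0 <= A. Proof. exact: le_trans (normr_ge0 _) (phi_le (lexx 0)). Qed.
Let B0 : 0 <= B. Proof. by have := phi'_le (lexx 0); rewrite mulr0. Qed.

Let s_le p : t p <= T -> `|s p| <= 1 + T.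
Proof.
move=> tp; have T0 : 0 <= T by exact: le_trans (t_ge0 p) tp.
have := le_trans (normal_component_sqr_le p) tp.
rewrite -real_normK ?num_real//; have := normr_ge0 (s p); nra.
Qed.

Let h_le p : `|h p| <= (1 + `|c0|) * (1 + k p ^+ 2).
Proof.
have h1 : `|h p| <= `|k p| + `|c0|.
  by rewrite (le_trans _ (ler_normD _ _))// /k subrK.
rewrite -(real_normK (num_real (k p))).
have := sqr_ge0 (`|k p| - 1); have := mulr_ge0 (normr_ge0 c0) (sqr_ge0 `|k p|).
have := sqr_ge0 `|k p|; rewrite !expr2; nra.
Qed.

Let i_sh : V.-integrable setT (EFin \o (fun p => phi (t p) * (s p * h p))).
Proof.
apply: (Rintegrable_ae_bounded measurableT _ _ (ik1 (A * ((1 + T) * (1 + `|c0|))))).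
  by apply: measurable_funM => //; apply: measurable_funM => //; exact: measurable_normal_component.
apply: filterS tT => p tp _; rewrite !normrM -!mulrA ler_pM//; first exact: phi_le.
by rewrite ler_pM// ?s_le ?h_le.
Qed.

Let i_s : V.-integrable setT (EFin \o (fun p => phi (t p) * s p)).
Proof.
apply: (Rintegrable_ae_bounded measurableT _ _ (ik1 (A * (1 + T)))).
  by apply: measurable_funM => //; exact: measurable_normal_component.
apply: filterS tT => p tp _; rewrite normrM.
have T0 : 0 <= T by exact: le_trans (t_ge0 p) tp.
rewrite -[leLHS]mulr1 ler_pM ?mulr_ge0//; last by rewrite lerDl sqr_ge0.
by rewrite ler_pM// ?phi_le ?s_le.
Qed.

Let i_div : V.-integrable setT
  (EFin \o (fun p => 2 * phi (t p) + 2 * phi' (t p) * (t p - s p ^+ 2))).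
Proof.
apply: (Rintegrable_bounded measurableT _ _ (ik1 (2 * A + 2 * B))).
  apply: measurable_funD; first exact: measurable_funM.
  apply: measurable_funM.
    by apply: measurable_funM => //; exact: (measurableT_comp mphi' measurable_sqdist_fst).
  apply: measurable_funB; first exact: measurable_sqdist_fst.
  by apply: measurable_funX; exact: measurable_normal_component.
move=> p _; have ss := normal_component_sqr_le p; have s2 := sqr_ge0 (s p).
apply: (@le_trans _ _ (2 * A + 2 * B)); last first.
  by rewrite ler_peMr ?lerDl ?sqr_ge0// addr_ge0// mulr_ge0.
apply: (le_trans (ler_normD _ _)); apply: lerD.
  by rewrite normrM ger0_norm// ler_pM2l// phi_le.
rewrite !normrM ger0_norm// -mulrA ler_pM2l//.
apply: le_trans (phi'_le (t_ge0 p)); rewrite ler_wpM2l// ger0_norm; lra.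
Qed.

Lemma first_variation_radial :
  \int[V]_p (2 * phi (t p) + 2 * phi' (t p) * (t p - s p ^+ 2)) =
  - \int[V]_p (phi (t p) * (s p * h p)).
Proof.
have C1X : C1 X by exact: C1_radial_field dphi cphi'.
have csX : compactly_supported X by exact: compactly_supported_radial_field phi0.
have := ev_first_variation VHE C1X csX.
have -> : first_variation V X =
    (\int[V]_p (2 * phi (t p) + 2 * phi' (t p) * (t p - s p ^+ 2))%:E)%E.
  apply: eq_integral => p _; congr EFin.
  have := G32_star_norm p.2; rewrite /s /n.
  have [v [w ->]] := G32_simple p.2; rewrite star_vwedge => n1.
  exact: divergence_along_radial_field.
have XH x : vdot (X x) (H x) = phi (sqd x) * vdot (x - x0) (H x).
  by rewrite /X /radial_field vdotZl.
have mXH : measurable_fun setT (fun x => phi (sqd x) * vdot (x - x0) (H x)).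
  apply: measurable_funM; first exact: (measurableT_comp mphi measurable_sqdist).
  exact: (measurable_fun_vdot measurableT measurable_sub_center (ev_H_measurable VHE)).
have mXHV : measurable_fun setT (fun p => phi (t p) * vdot (p.1 - x0) (H p.1)).
  exact: (measurableT_comp mXH measurable_fst).
have msh : measurable_fun setT (fun p => phi (t p) * (s p * h p)).
  by apply/measurable_EFinP; exact: measurable_int i_sh.
have XHV : {ae V, forall p, setT p ->
    phi (t p) * vdot (p.1 - x0) (H p.1) = phi (t p) * (s p * h p)}.
  by apply: filterS mean_curvature_normal => p -> _; rewrite vdotZr mulrC [s p * _]mulrC mulrC.
under [in X in _ = (- X)%E -> _]eq_integral do rewrite XH.
(* The integral is moved from R^3 to the Grassmann bundle before H is replaced by h n, since the
   normal n depends on the plane and not only on the point. *)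
rewrite /weight (@integral_pushforward _ _ _ _ _ fst measurable_fst)//; last 2 first.
- exact/measurable_EFinP.
- rewrite preimage_setT.
  apply: (Rintegrable_ae_bounded measurableT mXHV _ (integrable_norm i_sh)).
  by apply: filterS XHV => p hp _; rewrite hp.
rewrite preimage_setT => e; rewrite -(ae_eq_Rintegral measurableT mXHV msh XHV).
by rewrite /Rintegral e fineN.
Qed.

Lemma volume_radial :
  (- \int[V]_p (phi (t p) * s p)) =
  \int[leb3 R]_(x in E) ((3 * phi (sqd x) + 2 * phi' (sqd x) * sqd x) * (Theta x)%:R).
Proof.
have lX : lipschitz X by exact: lipschitz_radial_field dphi phi_le phi'_le.
have csX : compactly_supported X by exact: compactly_supported_radial_field phi0.
have := ev_volume VHE lX csX.
under [in X in (- X)%E = _ -> _]eq_integral do rewrite vdotZl.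
under [in X in _ = X -> _]eq_integral do rewrite (divergence_radial_field x0 dphi).
by rewrite /Rintegral => <-; rewrite fineN.
Qed.

Lemma flux_radial :
  \int[V]_p (2 * phi (t p) + 2 * phi' (t p) * (t p - s p ^+ 2) + s p * k p * phi (t p)) =
  c0 * \int[leb3 R]_(x in E) ((3 * phi (sqd x) + 2 * phi' (sqd x) * sqd x) * (Theta x)%:R).
Proof.
rewrite -volume_radial.
transitivity (\int[V]_p (2 * phi (t p) + 2 * phi' (t p) * (t p - s p ^+ 2)
   + (phi (t p) * (s p * h p) + (- c0) * (phi (t p) * s p)))).
  by apply: eq_Rintegral => p _; rewrite /k; ring.
have i3 := RintegrableZ measurableT (- c0) i_s.
have i23 := RintegrableD measurableT i_sh i3.
rewrite (RintegralD measurableT i_div i23) (RintegralD measurableT i_sh i3).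
by rewrite (RintegralZl (- c0) measurableT i_s) first_variation_radial; ring.
Qed.

End radial_test_field.

(** The cutoff disappears here: almost everywhere, for V and on E, the squared distance is at most
    T, where the profile coincides with 1 / softmax. *)
Lemma flux_identity tau delta : 0 < tau -> 0 < delta ->
  \int[V]_p (2 * (softmax tau delta (t p))^-1
    - 2 * (softmax' tau delta (t p) / softmax tau delta (t p) ^+ 2) * (t p - s p ^+ 2)
    + s p * k p * (softmax tau delta (t p))^-1) =
  c0 * \int[leb3 R]_(x in E)
    ((3 * (softmax tau delta (sqd x))^-1
      - 2 * (softmax' tau delta (sqd x) / softmax tau delta (sqd x) ^+ 2) * sqd x)
     * (Theta x)%:R).
Proof.
move=> p0 d0.
have [phi [phi' [dphi cphi' phi0 [A [B [phiA phiB]]] phiT]]] := cutoff_profile T p0 d0.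
have := flux_radial dphi cphi' phi0 phiA phiB.
have mphi : measurable_fun setT phi.
  apply: continuous_measurable_fun => x; apply: differentiable_continuous.
  by apply/derivable1_diffP; have [] := dphi x.
have mphi' : measurable_fun setT phi' by exact: continuous_measurable_fun.
have ma := measurable_softmaxV p0 d0; have mb := measurable_softmax_slope p0 d0.
have mt := measurable_sqdist_fst; have ms := measurable_normal_component.
have mk := measurable_curvature_excess.
have mts : measurable_fun setT (fun p => t p - s p ^+ 2).
  by apply: measurable_funB => //; exact: measurable_funX.
have msk : measurable_fun setT (fun p => s p * k p) by exact: measurable_funM.
have mE := ev_E_measurable VHE.
have mu : measurable_fun (E : set (@lebesgue_R3 R)) (sqd : @lebesgue_R3 R -> R).
  exact: measurable_funTS (borel_lebesgue_measurable_fun measurable_sqdist).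
have mw := measurable_fun_natr (ev_Theta_measurable VHE).
have eV : \int[V]_p (2 * phi (t p) + 2 * phi' (t p) * (t p - s p ^+ 2) + s p * k p * phi (t p)) =
  \int[V]_p (2 * (softmax tau delta (t p))^-1
    - 2 * (softmax' tau delta (t p) / softmax tau delta (t p) ^+ 2) * (t p - s p ^+ 2)
    + s p * k p * (softmax tau delta (t p))^-1).
  apply: ae_eq_Rintegral => //.
  - apply: measurable_funD; [apply: measurable_funD|].
    + by apply: measurable_funM => //; exact: (measurableT_comp mphi mt).
    + by do 2 apply: measurable_funM => //; exact: (measurableT_comp mphi' mt).
    + by apply: measurable_funM => //; exact: (measurableT_comp mphi mt).
  - apply: measurable_funD; [apply: measurable_funB|].
    + by apply: measurable_funM => //; exact: (measurableT_comp ma mt).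
    + by do 2 apply: measurable_funM => //; exact: (measurableT_comp mb mt).
    + by apply: measurable_funM => //; exact: (measurableT_comp ma mt).
  - by apply: filterS tT => p /phiT [-> ->] _; ring.
have eE : \int[leb3 R]_(x in E) ((3 * phi (sqd x) + 2 * phi' (sqd x) * sqd x) * (Theta x)%:R) =
  \int[leb3 R]_(x in E)
    ((3 * (softmax tau delta (sqd x))^-1
      - 2 * (softmax' tau delta (sqd x) / softmax tau delta (sqd x) ^+ 2) * sqd x)
     * (Theta x)%:R).
  apply: (@ae_eq_Rintegral _ _ _ (leb3 R) E mE).
  - exact: (measurable_radial_divergence mphi mphi' mu mw).
  - under eq_fun do rewrite -mulNr -mulrN.
    exact: (measurable_radial_divergence ma (measurable_funN mb) mu mw).
  - apply: negligibleS uT => x /=; apply: contra_not => h1 Ex.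
    by have [-> ->] := phiT _ (h1 Ex); ring.
by rewrite eV eE.
Qed.

End flux_identity.

(** * The density bound *)

(** For almost every p, H = h n with |n| = 1, so |H - c0 n|^2 = (h - c0)^2. Finite energy thus
    becomes square integrability of a scalar function. *)
Lemma helfrich_finite (R : realType) (c0 : R)
    (V : {measure set (R3 R * G32 R) -> \bar R}) (H : R3 R -> R3 R)
    (E : set (R3 R)) (Theta : R3 R -> nat) :
  enclosed_volume V H E Theta -> (helfrich c0 V H < +oo)%E ->
  V.-integrable setT
    (EFin \o (fun p => (vdot (H p.1) (star (biv p.2)) - c0) ^+ 2)) /\
  helfrich c0 V H =
    (4^-1 * \int[V]_p (vdot (H p.1) (star (biv p.2)) - c0) ^+ 2)%:E.
Proof.
move=> VHE hel.
set k2 := (fun p : R3 R * G32 R => (vdot (H p.1) (star (biv p.2)) - c0) ^+ 2).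
have mk : measurable_fun setT k2.
  by apply: measurable_funX; exact: measurable_curvature_excess VHE.
have mn : measurable_fun [set: R3 R * G32 R] (fun p => star (biv p.2)).
  exact: (measurableT_comp measurable_star_biv measurable_snd).
have mH : measurable_fun [set: R3 R * G32 R] (fun p => H p.1).
  exact: (measurableT_comp (ev_H_measurable VHE) measurable_fst).
(* The square expanded with |n| = 1 only, which holds everywhere and exhibits measurability; the
   equality with [k2] holds almost everywhere. *)
pose q (p : R3 R * G32 R) : R := vdot (H p.1) (H p.1)
  - 2 * c0 * vdot (H p.1) (star (biv p.2)) + c0 ^+ 2.
have qE p : vnorm (H p.1 - c0 *: star (biv p.2)) ^+ 2 = q p.
  rewrite vnorm_sqr vdotBr -scaleN1r !vdotDl !vdotZl !vdotZr G32_star_norm.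
  by rewrite /q (vdotC (star _)); ring.
have mq : measurable_fun setT q.
  apply: measurable_funD => //; apply: measurable_funB.
    exact: (measurable_fun_vdot measurableT mH mH).
  apply: measurable_funM => //.
  exact: (measurable_fun_vdot measurableT mH mn).
have intE : (\int[V]_p (vnorm (H p.1 - c0 *: star (biv p.2)) ^+ 2)%:E =
    \int[V]_p (k2 p)%:E)%E.
  under eq_integral do rewrite qE.
  apply: ae_eq_integral => //; [exact/measurable_EFinP|exact/measurable_EFinP|].
  apply: filterS (mean_curvature_normal VHE) => p Hp _; congr EFin.
  rewrite /q /k2 Hp !(vdotZl, vdotZr) G32_star_norm; ring.
move: hel; rewrite /helfrich intE => hel.
have k20 p : setT p -> (0 <= (k2 p)%:E)%E by rewrite lee_fin sqr_ge0.
have ik : V.-integrable setT (EFin \o k2).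
  apply/integrableP; split; first exact/measurable_EFinP.
  under eq_integral do rewrite gee0_abs ?k20//.
  rewrite ltey; apply/eqP => ky; move: hel.
  by rewrite ky gt0_muley ?ltxx// lte_fin invr_gt0.
split => //; rewrite EFinM /Rintegral fineK//; exact: integrable_fin_num.
Qed.

Lemma cvg_sqr_at_right0 (R : realType) : r ^+ 2 @[r --> (0 : R)^'+] --> (0 : R)^'+.
Proof.
move=> A [e /= e0 hA]; rewrite !near_simpl; near=> r.
have r0 : 0 < r by near: r; exact: nbhs_right_gt.
have r1 : r < 1 by near: r; exact: nbhs_right_lt.
have re : r < e by near: r; exact: nbhs_right_lt.
apply: hA; last by rewrite exprn_gt0.
by rewrite /ball_/= sub0r normrN gtr0_norm ?exprn_gt0//; nra.
Unshelve. all: by end_near. Qed.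

Theorem corollary4p11 (R : realType) (c0 : R)
    (V : {measure set (R3 R * G32 R) -> \bar R}) (H : R3 R -> R3 R)
    (E : set (R3 R)) (Theta : R3 R -> nat)
    (VHE : enclosed_volume V H E Theta)
    (spt_compact : compact (spt (weight V))) (x0 : R3 R)
    (second_term_exists : lebesgue3.-integrable E
       (fun x : R3 R => ((Theta x)%:R / vnorm (x - x0) ^+ 2)%:E)) :
  ((helfrich c0 V H < +oo)%E ->
     cvg (density_ratio (weight V) x0 r @[r --> 0^'+])) /\
  (density2 (weight V) x0 <=
     ((4 * pi)^-1)%:E * helfrich c0 V H +
     (c0 / (2 * pi))%:E *
       \int[lebesgue3]_(x in E) ((Theta x)%:R / vnorm (x - x0) ^+ 2)%:E)%E.
Proof.
have mE := ev_E_measurable VHE.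
have pi0 := pi_gt0 R.
have Ifin := @integrable_fin_num _ _ _ (leb3 R) E mE _ second_term_exists.
(* With infinite energy the right side is +oo, because the second term is finite. The bound then
   holds whatever value the total operator [lim] returns. *)
have [hel|hel] := pselect (helfrich c0 V H < +oo)%E; last first.
  split => //.
  have -> : helfrich c0 V H = +oo%E.
    by apply/eqP; move/negP: hel; rewrite -leNgt leye_eq.
  rewrite gt0_muley; last by rewrite lte_fin invr_gt0 mulr_gt0.
  have : ((c0 / (2 * pi))%:E * \int[lebesgue3]_(x in E)
      ((Theta x)%:R / vnorm (x - x0) ^+ 2)%:E)%E \is a fin_num by exact: fin_numM.
  by rewrite fin_numE => /andP[h _]; rewrite addye ?leey.
have [ik helE] := helfrich_finite VHE hel.
have Vfin := oriented_varifold_finite (ev_varifold VHE) spt_compact.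
have [r1 r10 hr1] := compact_sqdist_bounded x0 spt_compact.
have [r2 hr2] := enclosed_region_bounded x0 VHE spt_compact.
(* A single T for the support of the weight and for E, since one test field is used in both
   identities. *)
pose T := Num.max r1 r2.
pose sqd (x : R3 R) : R := vdot (x - x0) (x - x0).
have tT : {ae V, forall p, sqd p.1 <= T}.
  by apply: filterS (weight_spt_ae V) => p /hr1 h; rewrite le_max h.
have uT : {ae (leb3 R), forall x, E x -> sqd x <= T}.
  apply: negligibleS hr2 => x /=; apply: contra_not => h Ex.
  by rewrite le_max h ?orbT.
(* Only x0 has distance 0, and a point is Lebesgue null. It must be excluded because division by 0
   gives 0 there, so that w / u would not dominate. *)
have uT0 : {ae (leb3 R), forall x, E x -> 0 < sqd x <= T}.
  have n0 : (leb3 R).-negligible [set x0].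
    exists [set x0]; split => //; last exact: lebesgue3_set1.
    exact: (borel_lebesgue_measurable (@measurable_set1_R3 _ x0)).
  apply: negligibleS (negligibleU uT n0) => x /=.
  move=> /not_implyP[Ex /negP]; rewrite negb_and => /orP[h|h]; last first.
    by left => /(_ Ex); exact/negP.
  have xx0 : (x : R3 R) - x0 = 0.
    by apply: vdot_eq0; apply/eqP; rewrite eq_le vdot_ge0 andbT leNgt.
  by right; rewrite -[x0]add0r -xx0 subrK.
have mu : measurable_fun (E : set (@lebesgue_R3 R)) (sqd : @lebesgue_R3 R -> R).
  exact: measurable_funTS (borel_lebesgue_measurable_fun (@measurable_sqdist R x0)).
have mw := measurable_fun_natr (ev_Theta_measurable VHE).
have iwu : (leb3 R).-integrable E (EFin \o (fun x => (Theta x)%:R / sqd x)).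
  have -> : EFin \o (fun x => (Theta x)%:R / sqd x) =
      (fun x : R3 R => ((Theta x)%:R / vnorm (x - x0) ^+ 2)%:E).
    by apply/funext => x /=; rewrite vnorm_sqr.
  exact: second_term_exists.
have [l lle lcvg] := area_ratio_cvg Vfin (@measurable_sqdist_fst R x0)
  (@measurable_normal_component R x0) (measurable_curvature_excess c0 VHE)
  (@normal_component_sqr_le R x0) tT ik mE mu mw (fun x _ => ler0n _ _) uT0 iwu
  (flux_identity VHE Vfin tT uT ik).
have dcvg : density_ratio (weight V) x0 r @[r --> 0^'+] --> (l / pi)%:E.
  have hc : fine (V [set p | sqd p.1 <= r ^+ 2]) / r ^+ 2 / pi @[r --> 0^'+] --> l / pi.
    apply: cvgMl.
    exact: (cvg_comp _ _ (@cvg_sqr_at_right0 R) lcvg).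
  have hc' : (fine (V [set p | sqd p.1 <= r ^+ 2]) / r ^+ 2 / pi)%:E @[r --> 0^'+] -->
      (l / pi)%:E by apply: cvg_EFin => //; near=> r.
  apply: cvg_trans hc'.
  apply: near_eq_cvg; near=> r.
  have r0 : 0 < r by near: r; exact: nbhs_right_gt.
  rewrite /density_ratio /weight /pushforward.
  have -> : fst @^-1` cball x0 r = [set p : R3 R * G32 R | sqd p.1 <= r ^+ 2].
    apply/funext => p; apply/propext; rewrite /cball /= /sqd -vnorm_sqr.
    by rewrite ler_pXn2r// nnegrE ?sqrtr_ge0// ltW.
  have Vf : V [set p | sqd p.1 <= r ^+ 2] \is a fin_num.
    rewrite ge0_fin_numE ?measure_ge0//; apply: le_lt_trans Vfin.
    apply: le_measure; rewrite ?inE//.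
    rewrite (_ : mkset _ = setT `&` (fun p : R3 R * G32 R => sqd p.1) @^-1` `]-oo, r ^+ 2]%classic).
      exact: measurable_sqdist_fst.
    by rewrite setTI; apply/seteqP; split => p /=; rewrite in_itv.
  rewrite -[in RHS](fineK Vf) -EFinM; congr EFin.
  have e : (pi * r ^+ 2)^-1 = (r ^+ 2)^-1 / pi by rewrite invfM mulrC.
  by rewrite e mulrA.
split; first by move=> _; apply/cvg_ex; exists (l / pi)%:E.
rewrite /density2 (cvg_lim _ dcvg)//.
have -> : (\int[lebesgue3]_(x in E) ((Theta x)%:R / vnorm (x - x0) ^+ 2)%:E)%E =
    (\int[leb3 R]_(x in E) ((Theta x)%:R / sqd x))%:E.
  rewrite /Rintegral fineK; last exact: (integrable_fin_num mE iwu).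
  by apply: eq_integral => x _; rewrite vnorm_sqr.
rewrite helE -!EFinM -EFinD lee_fin.
move: lle; set K := Rintegral _ _ _; set W := Rintegral _ _ _ => lle.
rewrite ler_pdivrMr//.
(* The energy is K / 4, so after multiplication by [pi] its coefficient 1 / (4 pi) produces the K /
   16 in the bound on l. *)
have alg (P : R) : 0 < P ->
    ((4 * P)^-1 * (4^-1 * K) + c0 / (2 * P) * W) * P = K / 16 + c0 / 2 * W.
  by move=> P0; field; rewrite gt_eqF.
by rewrite alg.
Unshelve. all: by end_near. Qed.
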